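(* There exists a constant $C_0>0$ such that for every analytic map $\phi\colon\mathbb{D}\to\mathbb{D}$, $$\mathcal{A}\big(\{z\in\mathbb{D}:\phi(z)\in S(\xi,\varepsilon h)\}\big)\le C_0\,\varepsilon^2\,\mathcal{A}\big(\{z\in\mathbb{D}:\phi(z)\in S(\xi,h)\}\big)$$ for every $\xi\in\mathbb{T}$, every $0<h<1-|\phi(0)|$ and every $0<\varepsilon\le1$.
   Context: $\mathbb{D}$ is the open unit disk, $\mathbb{T}$ the unit circle, $\mathcal{A}$ the normalized area measure $dx\,dy/\pi$ on $\mathbb{D}$. For $\xi\in\mathbb{T}$ and $h>0$, $S(\xi,h)=\{z\in\mathbb{D}:|z-\xi|<h\}$. *)

(* Defs.v *)
From HB Require Import structures.
From mathcomp Require Import all_boot all_order all_algebra.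
From mathcomp Require Import all_classical all_reals all_analysis.
From mathcomp Require Import complex.
Set Implicit Arguments. Unset Strict Implicit. Unset Printing Implicit Defensive.
Import Order.TTheory GRing.Theory Num.Theory.
Import numFieldNormedType.Exports.
Local Open Scope classical_set_scope.
Local Open Scope ring_scope.

Definition unit_disk (R : realType) : set R[i] :=
  [set z | ComplexField.Normc.normc z < 1].

(* R[i]^o carries MathComp-Analysis' normed (metric) topology given by the
   complex modulus. *)
Definition complex_differentiable (R : realType) (f : R[i] -> R[i]) (z : R[i]) :=
  exists l : R[i]^o,
    (fun w : R[i]^o => ((f (z + w) - f z) / w : R[i]^o)) @ (0 : R[i]^o)^' --> l.

Definition analytic_on_disk (R : realType) (f : R[i] -> R[i]) :=
  forall z, unit_disk z -> complex_differentiable f z.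

Definition area (R : realType) (A : set R[i]) : \bar R :=
  ((pi : R)^-1)%:E *
  ((@lebesgue_measure R) \x (@lebesgue_measure R))
     [set p : R * R | A (Complex p.1 p.2)].

Definition carleson_box (R : realType) (xi : R[i]) (h : R) : set R[i] :=
  [set z | unit_disk z /\ ComplexField.Normc.normc (z - xi) < h].

(* Main.v *)
(** Put q(z) = 1 - conj(xi) phi(z). It is analytic with Re q > 0, |q| = |phi - xi|
    and |q(0)| > h, and the claim is |E(eps h)| <= C eps^2 |E(h)| for the
    sublevel sets E(t) = {|q| < t}.

    For t = eps h the function u = Re (t / (t + q)) is positive and harmonic, at
    least 1/2 on E(t) and at most min(1, t / |q|). By Harnack's inequality a
    point z of E(t) has, about N = c / eps times farther from the circle, a
    neighbourhood contained in E(h), of diameter comparable to N (1 - |z|);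
    here |q(0)| > h ensures that N (1 - |z|) < 1/4. Conversely, the Poisson
    formula on circles bounds by a multiple of N^-1 (1 - |w|)^2 u(w) the area of
    the points of E(t) associated with a point w of E(h). Counting the
    pairs (z, w) in two ways gives |E(eps h)| <= C eps * integral of u over E(h).

    Since u <= min(1, t / |q|), for eps = 2^-n this reads
    a_n <= C 4^-n (sum of 2^k a_k over k <= n) with a_k = |E(2^-k h)|, and a
    recursion of this kind forces a_n <= K 4^-n a_0. *)
Require Import Defs.
From HB Require Import structures.
From mathcomp Require Import all_boot all_order all_algebra.
From mathcomp Require Import all_classical all_reals all_analysis.
From mathcomp Require Import measurable_realfun complex.
From mathcomp Require Import ring lra.
Import Order.TTheory GRing.Theory Num.Theory.
Import numFieldNormedType.Exports.
Local Open Scope classical_set_scope.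
Local Open Scope ring_scope.
Set Implicit Arguments.
Unset Strict Implicit.
Unset Printing Implicit Defensive.

(** * Goursat's theorem on rectangles *)

Section Goursat.
Variable R : realType.

(** Counting pairs gains only one factor [eps], since [N] is of order [1 / eps]. The second factor
    comes from the decay [t / |q|] of [u]: with [u] replaced by 1 the same count would end at
    [C eps |E(h)|]. The resulting recursion improves itself. From a_k <= a_0 the sum is O(2^n) a_0,
    so a_n = O(2^-n) a_0; then the sum is O(n) a_0, so a_n = O(n 4^-n) a_0; then the sum is bounded.

    Analyticity means complex differentiability at each point, without continuity of the derivative,
    so the Poisson formula is built on Goursat's bisection. The exponential map turns a rectangle of
    height 2 pi into an annulus whose two horizontal sides cancel by periodicity. This gives mean
    values over circles, and the Poisson formula is the mean value property of one auxiliary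
    function with a removable singularity. *)

Lemma nested_intervals_point (a b : R^nat) :
  (forall n, a n <= b n) -> (forall n, a n <= a n.+1) ->
  (forall n, b n.+1 <= b n) -> exists x, forall n, a n <= x <= b n.
Proof.
move=> ab ai bd.
have aS m k : a m <= a (m + k)%N.
  by elim: k => [|k IH]; rewrite ?addn0// addnS (le_trans IH).
have bS m k : b (m + k)%N <= b m.
  by elim: k => [|k IH]; rewrite ?addn0// addnS (le_trans _ IH).
have ub m : ubound (range a) (b m).
  move=> _ [k _ <-].
  by rewrite (le_trans (aS k m))// (le_trans (ab _))// addnC.
have hs : has_sup (range a) by split; [exists (a 0%N), 0%N|exists (b 0%N)].
exists (sup (range a)) => n; apply/andP; split.
  by apply: ub_le_sup; [case: hs|exists n].
by apply: ge_sup; [case: hs|exact: ub].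
Qed.

Variable D : R -> R -> R -> R -> R.

Definition quarter (Q : R * R * (R * R)) : R * R * (R * R) :=
  let: ((a, b), (c, d)) := Q in
  let m := (a + b) / 2 in let n := (c + d) / 2 in
  let e := `|D a b c d| / 4 in
  if e <= `|D a m c n| then ((a, m), (c, n))
  else if e <= `|D m b c n| then ((m, b), (c, n))
  else if e <= `|D a m n d| then ((a, m), (n, d))
  else ((m, b), (n, d)).

Let Dq (Q : R * R * (R * R)) := D Q.1.1 Q.1.2 Q.2.1 Q.2.2.

Variables a0 b0 c0 d0 : R.
Hypothesis ab0 : a0 <= b0.
Hypothesis cd0 : c0 <= d0.
Hypothesis D_addl : forall a m b c d, a0 <= a -> a <= m -> m <= b -> b <= b0 ->
  c0 <= c -> c <= d -> d <= d0 -> D a b c d = D a m c d + D m b c d.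
Hypothesis D_addr : forall a b c m d, a0 <= a -> a <= b -> b <= b0 ->
  c0 <= c -> c <= m -> m <= d -> d <= d0 -> D a b c d = D a b c m + D a b m d.

Let inside (Q : R * R * (R * R)) := [/\ a0 <= Q.1.1, Q.1.1 <= Q.1.2, Q.1.2 <= b0 &
  [/\ c0 <= Q.2.1, Q.2.1 <= Q.2.2 & Q.2.2 <= d0]].

(** [D] is the sum of its values on the four quarters. If the first three each fall short of a
    fourth of [|D|], the triangle inequality leaves at least a fourth to the last, which [quarter]
    therefore takes without a test. *)
Lemma quarter_le Q : inside Q -> `|Dq Q| / 4 <= `|Dq (quarter Q)|.
Proof.
move: Q => [[a b] [c d]] [/= aa ab bb [cc cd dd]]; rewrite /quarter /Dq.
set m := (a + b) / 2; set n := (c + d) / 2.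
have am : a <= m by rewrite /m; lra.
have mb : m <= b by rewrite /m; lra.
have cn : c <= n by rewrite /n; lra.
have nd : n <= d by rewrite /n; lra.
have E : D a b c d = D a m c n + D m b c n + (D a m n d + D m b n d).
  rewrite (@D_addr a b c n d)// (@D_addl a m b c n)//; last exact: le_trans dd.
  by rewrite (@D_addl a m b n d)//; exact: le_trans cn.
case: (lerP _ `|D a m c n|) => [//|h1].
case: (lerP _ `|D m b c n|) => [//|h2].
case: (lerP _ `|D a m n d|) => [//|h3] /=.
have := ler_normD (D a m c n + D m b c n) (D a m n d + D m b n d).
have := ler_normD (D a m c n) (D m b c n).
have := ler_normD (D a m n d) (D m b n d).
rewrite -E; lra.
Qed.

Lemma quarter_sub Q : inside Q ->
  [/\ inside (quarter Q), Q.1.1 <= (quarter Q).1.1, (quarter Q).1.2 <= Q.1.2,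
      Q.2.1 <= (quarter Q).2.1 & (quarter Q).2.2 <= Q.2.2] /\
  ((quarter Q).1.2 - (quarter Q).1.1 = (Q.1.2 - Q.1.1) / 2 /\
   (quarter Q).2.2 - (quarter Q).2.1 = (Q.2.2 - Q.2.1) / 2).
Proof.
move: Q => [[a b] [c d]] [/= aa ab bb [cc cd dd]].
by do ![case: ifP => _ /=]; (split; [split; first split => /=; try split|split]; lra).
Qed.

(* Goursat's bisection: |D| on the k-th rectangle is at least 4^-k |D|, whereas
   the hypothesis makes it o(4^-k) around the common point. *)
Lemma additive_rectangle_eq0 :
  (forall x y e, a0 <= x <= b0 -> c0 <= y <= d0 -> 0 < e ->
    exists2 del, 0 < del & forall a b c d,
      a0 <= a -> a <= x -> x <= b -> b <= b0 -> b - a < del ->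
      c0 <= c -> c <= y -> y <= d -> d <= d0 -> d - c < del ->
      `|D a b c d| <= e * ((b - a) + (d - c)) ^+ 2) ->
  D a0 b0 c0 d0 = 0.
Proof.
move=> loc.
pose Q k := iter k quarter ((a0, b0), (c0, d0)).
have QS k : Q k.+1 = quarter (Q k) by [].
have inQ k : inside (Q k).
  elim: k => [|k IH]; first by split => //=; split.
  by rewrite QS; case: (quarter_sub IH).1.
have sub k := (quarter_sub (inQ k)).1.
have wQ k : (Q k).1.2 - (Q k).1.1 = (b0 - a0) / 2 ^+ k.
  elim: k => [|k IH]; first by rewrite expr0 divr1.
  by rewrite QS (quarter_sub (inQ k)).2.1 IH exprS invfM; lra.
have vQ k : (Q k).2.2 - (Q k).2.1 = (d0 - c0) / 2 ^+ k.
  elim: k => [|k IH]; first by rewrite expr0 divr1.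
  by rewrite QS (quarter_sub (inQ k)).2.2 IH exprS invfM; lra.
have big k : `|D a0 b0 c0 d0| / 4 ^+ k <= `|Dq (Q k)|.
  elim: k => [|k IH]; first by rewrite expr0 divr1.
  by rewrite QS (le_trans _ (quarter_le (inQ k)))// exprS invfM; lra.
have [x Hx] : exists x, forall k, (Q k).1.1 <= x <= (Q k).1.2.
  apply: nested_intervals_point => k; first by case: (inQ k).
    by case: (sub k).
  by case: (sub k).
have [y Hy] : exists y, forall k, (Q k).2.1 <= y <= (Q k).2.2.
  apply: nested_intervals_point => k; first by case: (inQ k) => _ _ _ [].
    by case: (sub k).
  by case: (sub k).
apply/eqP; rewrite -normr_eq0 eq_le normr_ge0 andbT.
set S := (b0 - a0) + (d0 - c0).
have S0 : 0 <= S by rewrite addr_ge0// subr_ge0.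
(* The [+ 1] keeps the factor positive even when the rectangle is a single point. *)
suff H e : 0 < e -> `|D a0 b0 c0 d0| <= e * (S ^+ 2 + 1).
  apply/ler_addgt0Pr => e e0; rewrite add0r.
  have p0 : 0 < S ^+ 2 + 1 by rewrite ltr_wpDl// sqr_ge0.
  have := H (e / (S ^+ 2 + 1)) (divr_gt0 e0 p0).
  by rewrite divfK// gt_eqF.
move=> e0.
have [del del0 Hd] := loc x y e (Hx 0%N) (Hy 0%N) e0.
have [k Hk] : exists k, S / 2 ^+ k < del.
  have := @cvg_geometric R S 2^-1; rewrite ger0_norm ?invr_ge0//.
  have h : (2^-1 : R) < 1 by lra.
  move=> /(_ h) /cvgrPdist_lt /(_ _ del0) [k _ /(_ k (leqnn k))].
  rewrite sub0r normrN /geometric/= exprVn ger0_norm ?divr_ge0 ?exprn_ge0//.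
  by exists k.
have [/andP[x1 x2] /andP[y1 y2]] := (Hx k, Hy k).
have [i1 i2 i3 [i4 i5 i6]] := inQ k.
have p2 : 0 < (2 ^+ k : R) by rewrite exprn_gt0.
have := Hd (Q k).1.1 (Q k).1.2 (Q k).2.1 (Q k).2.2 i1 x1 x2 i3.
rewrite wQ => /(_ (le_lt_trans _ Hk)).
rewrite ler_pM2r ?invr_gt0// => /(_ _ i4 y1 y2 i6).
have -> : b0 - a0 <= S by rewrite lerDl subr_ge0.
rewrite vQ => /(_ isT (le_lt_trans _ Hk)).
rewrite ler_pM2r ?invr_gt0//.
have -> : d0 - c0 <= S by rewrite lerDr subr_ge0.
move=> /(_ isT) /(le_trans (big k)).
rewrite -mulrDl -/S expr_div_n mulrA.
have -> : (2 ^+ k) ^+ 2 = 4 ^+ k :> R.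
  by rewrite -exprM mulnC exprM; congr (_ ^+ _); rewrite expr2; lra.
rewrite ler_pM2r ?invr_gt0 ?exprn_gt0// => /le_trans; apply.
by rewrite ler_pM2l// lerDl.
Qed.

End Goursat.

(** * Integrals over segments *)

Section SegmentIntegrals.
Variable R : realType.
Local Notation mu := (@lebesgue_measure R).
Implicit Types (f g : R -> R).

Lemma integrable_segment f (a b : R) :
  (forall x, a <= x <= b -> {for x, continuous f}) ->
  mu.-integrable `[a, b] (EFin \o f).
Proof.
move=> cf; apply: continuous_compact_integrable; first exact: segment_compact.
apply: continuous_in_subspaceT => x; rewrite inE/= in_itv/=; exact: cf.
Qed.

Lemma Rintegral_segment_split f (a m b : R) : a <= m -> m <= b ->
  (forall x, a <= x <= b -> {for x, continuous f}) ->
  (\int[mu]_(x in `[a, b]) f x =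
   \int[mu]_(x in `[a, m]) f x + \int[mu]_(x in `[m, b]) f x)%R.
Proof.
move=> am mb cf; have If := integrable_segment cf.
apply/eqP; rewrite addrC -subr_eq; apply/eqP.
rewrite (Rintegral_itvB If) ?bnd_simp// Rintegral_itv_obnd_cbnd//.
apply: integrableS If => // x /=; rewrite !in_itv/= => /andP[mx ->].
by rewrite (le_trans am (ltW mx)).
Qed.

Lemma Rintegral_segment_cst (a b k : R) : a <= b ->
  (\int[mu]_(x in `[a, b]) k = k * (b - a))%R.
Proof.
move=> ab; rewrite Rintegral_cst//; congr (_ * _).
rewrite -[RHS]/(fine (b - a)%:E); congr fine.
apply: etrans (lebesgue_measure_itv _) _; rewrite /= lte_fin; case: ltP => //= ba.
by rewrite [b](@le_anti _ _ b a) ?ab ?ba// subrr.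
Qed.

Lemma Rintegral_segment_le f (a b K M : R) : a <= b ->
  (forall x, a <= x <= b -> {for x, continuous f}) ->
  (forall x, a <= x <= b -> `|f x - K| <= M) ->
  `|(\int[mu]_(x in `[a, b]) f x)%R - K * (b - a)| <= M * (b - a).
Proof.
move=> ab cf fM.
have If := integrable_segment cf.
have cI (k : R) : mu.-integrable `[a, b] (EFin \o (fun=> k)).
  by apply: integrable_segment => x _; exact: cvg_cst.
have IB : mu.-integrable `[a, b] (EFin \o (fun x => f x - K)).
  apply: integrable_segment => x xab.
  by apply: cvgB; [exact: cf|exact: cvg_cst].
rewrite -!Rintegral_segment_cst// -RintegralB//.
apply: (le_trans (le_normr_Rintegral _ _)) => //.
apply: le_Rintegral => //.
  have := integrable_abse IB.
  by rewrite [X in _.-integrable _ X -> _](_ : _ = EFin \o (fun x => `|f x - K|))//.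
Qed.
End SegmentIntegrals.

(* [A + iB] has complex derivative [p + iq] at [x + iy]. *)
Definition conformal_at {R : realType} (A B : R -> R -> R) (x y : R) :=
  exists p q : R, forall e : R, 0 < e -> exists2 d : R, 0 < d &
    forall x' y', `|x' - x| < d -> `|y' - y| < d ->
    `|A x' y' - A x y - (p * (x' - x) - q * (y' - y))|
      <= e * (`|x' - x| + `|y' - y|) /\
    `|B x' y' - B x y - (q * (x' - x) + p * (y' - y))|
      <= e * (`|x' - x| + `|y' - y|).

Section GoursatRectangle.
Variable R : realType.
Local Notation mu := (@lebesgue_measure R).
Implicit Types A B : R -> R -> R.

Lemma conformal_continuous A B x y : conformal_at A B x y ->
  {for y, continuous (A x)} /\ {for x, continuous (B ^~ y)}.
Proof.
move=> [p [q H]]; have [d d0 Hd] := H _ ltr01.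
split; apply/cvgrPdist_lt => e e0.
- near=> t; rewrite distrC.
  have h1 : `|t - y| < d by rewrite distrC; near: t; apply: cvgr_dist_lt.
  have h2 : `|t - y| < e / (`|q| + 2).
    rewrite distrC; near: t; apply: cvgr_dist_lt => //.
    by rewrite divr_gt0// ltr_wpDl.
  have := (Hd x t _ h1).1; rewrite subrr normr0 => /(_ d0).
  rewrite mulr0 !add0r mul1r opprK => h3.
  have -> : A x t - A x y = (A x t - A x y + q * (t - y)) - q * (t - y) by ring.
  apply: (le_lt_trans (ler_normB _ _)); rewrite normrM.
  apply: (le_lt_trans (lerD h3 (lexx _))).
  rewrite -[X in X + _]mul1r -mulrDl.
  rewrite ltr_pdivlMr in h2; last by rewrite ltr_wpDl.
  apply: le_lt_trans h2; rewrite mulrC ler_wpM2l//; lra.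
- near=> t; rewrite distrC.
  have h1 : `|t - x| < d by rewrite distrC; near: t; apply: cvgr_dist_lt.
  have h2 : `|t - x| < e / (`|q| + 2).
    rewrite distrC; near: t; apply: cvgr_dist_lt => //.
    by rewrite divr_gt0// ltr_wpDl.
  have := (Hd t y h1 _).2; rewrite subrr normr0 => /(_ d0).
  rewrite mulr0 !addr0 mul1r => h3.
  have -> : B t y - B x y = (B t y - B x y - q * (t - x)) + q * (t - x) by ring.
  apply: (le_lt_trans (ler_normD _ _)); rewrite normrM.
  apply: (le_lt_trans (lerD h3 (lexx _))).
  rewrite -[X in X + _]mul1r -mulrDl.
  rewrite ltr_pdivlMr in h2; last by rewrite ltr_wpDl.
  apply: le_lt_trans h2; rewrite mulrC ler_wpM2l//; lra.
Unshelve. all: by end_near. Qed.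

(** The imaginary part of Cauchy's theorem for the boundary of the rectangle: for [A + iB] the form
    integrated is [B dx + A dy]. It is additive under subdivision, and differentiability at a point
    makes it small relative to the square of the size of nearby rectangles. *)
Lemma Goursat_rectangle A B a0 b0 c0 d0 : a0 <= b0 -> c0 <= d0 ->
  (forall x y, a0 <= x <= b0 -> c0 <= y <= d0 -> conformal_at A B x y) ->
  (\int[mu]_(y in `[c0, d0]) A b0 y - \int[mu]_(y in `[c0, d0]) A a0 y =
   \int[mu]_(x in `[a0, b0]) B x d0 - \int[mu]_(x in `[a0, b0]) B x c0)%R.
Proof.
move=> ab0 cd0 AB.
pose IV x c d := (\int[mu]_(y in `[c, d]) A x y)%R.
pose IH y a b := (\int[mu]_(x in `[a, b]) B x y)%R.
pose D a b c d := IV b c d - IV a c d - (IH d a b - IH c a b).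
have cA x y : a0 <= x <= b0 -> c0 <= y <= d0 -> {for y, continuous (A x)}.
  by move=> hx hy; exact: (conformal_continuous (AB x y hx hy)).1.
have cB x y : a0 <= x <= b0 -> c0 <= y <= d0 -> {for x, continuous (B ^~ y)}.
  by move=> hx hy; exact: (conformal_continuous (AB x y hx hy)).2.
apply/eqP; rewrite -subr_eq0; apply/eqP.
apply: (@additive_rectangle_eq0 R D a0 b0 c0 d0 ab0 cd0).
- move=> a m b c d h1 h2 h3 h4 h5 h6 h7; rewrite /D.
  have S y : c0 <= y <= d0 -> IH y a b = IH y a m + IH y m b.
    move=> hy; apply: Rintegral_segment_split => // x /andP[ax xb].
    by apply: cB => //; rewrite (le_trans h1 ax) (le_trans xb h4).
  rewrite !S; first ring.
    by rewrite h5 (le_trans h6).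
  by rewrite h7 (le_trans h5).
- move=> a b c m d h1 h2 h3 h4 h5 h6 h7; rewrite /D.
  have S x : a0 <= x <= b0 -> IV x c d = IV x c m + IV x m d.
    move=> hx; apply: Rintegral_segment_split => // y /andP[cy yd].
    by apply: cA => //; rewrite (le_trans h4 cy) (le_trans yd h7).
  rewrite !S; first ring.
    by rewrite h1 (le_trans h2).
  by rewrite h3 (le_trans h1).
move=> x y e hx hy e0.
have [p [q Hpq]] := AB x y hx hy.
have [del del0 Hd] := Hpq (e / 2) (divr_gt0 e0 (ltr0n _ 2)).
exists del => // a b c d h1 h2 h3 h4 h5 h6 h7 h8 h9 h10.
have near1 u : a <= u <= b -> `|u - x| <= b - a /\ `|u - x| < del.
  move=> /andP[au ub]; have : `|u - x| <= b - a by rewrite ler_norml; lra.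
  by move=> h; split => //; exact: le_lt_trans h5.
have near2 v : c <= v <= d -> `|v - y| <= d - c /\ `|v - y| < del.
  move=> /andP[au ub]; have : `|v - y| <= d - c by rewrite ler_norml; lra.
  by move=> h; split => //; exact: le_lt_trans h10.
have ab : a <= b by lra.
have cd : c <= d by lra.
set M := e * ((b - a) + (d - c)).
have est u v : a <= u <= b -> c <= v <= d ->
  `|A u v - A x y - (p * (u - x) - q * (v - y))| <= M / 2 /\
  `|B u v - B x y - (q * (u - x) + p * (v - y))| <= M / 2.
  move=> /near1[u1 u2] /near2[v1 v2]; have [E1 E2] := Hd u v u2 v2.
  have le : e / 2 * (`|u - x| + `|v - y|) <= M / 2.
    by rewrite /M mulrAC ler_wpM2r ?invr_ge0// ler_wpM2l ?(ltW e0)// lerD.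
  by split; [exact: le_trans le|exact: le_trans le].
have ha : a <= a <= b by rewrite lexx.
have hb : a <= b <= b by rewrite lexx andbT.
have hc : c <= c <= d by rewrite lexx.
have hd : c <= d <= d by rewrite lexx andbT.
have inx u : a <= u <= b -> a0 <= u <= b0.
  by move=> /andP[au ub]; rewrite (le_trans h1 au) (le_trans ub h4).
have iny v : c <= v <= d -> c0 <= v <= d0.
  by move=> /andP[cv vd]; rewrite (le_trans h6 cv) (le_trans vd h9).
(* The linear parts contribute the same [p * (b - a) * (d - c)] to the vertical and to the
   horizontal difference, by the Cauchy-Riemann equations built into [conformal_at]. Only the errors
   survive in [D], at most [M / 2] for each of the two points compared. *)
have EV : `|IV b c d - IV a c d - p * (b - a) * (d - c)| <= M * (d - c).
  rewrite /IV -RintegralB//; last 2 first.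
  - by apply: integrable_segment => v hv; apply: cA; [exact: inx|exact: iny].
  - by apply: integrable_segment => v hv; apply: cA; [exact: inx|exact: iny].
  apply: Rintegral_segment_le => // v hv.
    by apply: cvgB; apply: cA; (try exact: inx); exact: iny.
  have [E1 _] := est b v hb hv; have [E2 _] := est a v ha hv.
  have -> : A b v - A a v - p * (b - a) =
     (A b v - A x y - (p * (b - x) - q * (v - y))) -
     (A a v - A x y - (p * (a - x) - q * (v - y))) by ring.
  by rewrite (le_trans (ler_normB _ _))// [leRHS](splitr M) lerD.
have EH : `|IH d a b - IH c a b - p * (d - c) * (b - a)| <= M * (b - a).
  rewrite /IH -RintegralB//; last 2 first.
  - by apply: integrable_segment => v hv; apply: cB; [exact: inx|exact: iny].
  - by apply: integrable_segment => v hv; apply: cB; [exact: inx|exact: iny].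
  apply: Rintegral_segment_le => // v hv.
    by apply: cvgB; apply: cB; (try exact: inx); exact: iny.
  have [_ E1] := est v d hv hd; have [_ E2] := est v c hv hc.
  have -> : B v d - B v c - p * (d - c) =
     (B v d - B x y - (q * (v - x) + p * (d - y))) -
     (B v c - B x y - (q * (v - x) + p * (c - y))) by ring.
  by rewrite (le_trans (ler_normB _ _))// [leRHS](splitr M) lerD.
have -> : D a b c d = (IV b c d - IV a c d - p * (b - a) * (d - c)) -
  (IH d a b - IH c a b - p * (d - c) * (b - a)) by rewrite /D; ring.
apply: (le_trans (ler_normB _ _)); apply: (le_trans (lerD EV EH)).
by rewrite -mulrDr /M addrC -mulrA -expr2 [X in _ * X ^+ 2]addrC.
Qed.

End GoursatRectangle.

(** * The Poisson formula *)

Import ComplexField.Normc.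

(** * Complex modulus, differentiability and continuity *)

Section ComplexCalculus.
Variable R : realType.
Local Notation C := R[i].
Local Notation nc := (@normc R).
Implicit Types (f k : C -> C) (z w : C).

Lemma normc_sqrtE z : nc z = Num.sqrt (complex.Re z ^+ 2 + complex.Im z ^+ 2).
Proof. by case: z. Qed.
Lemma normc_ge0 z : 0 <= nc z. Proof. by rewrite normc_sqrtE sqrtr_ge0. Qed.
Lemma sqr_normc z : nc z ^+ 2 = complex.Re z ^+ 2 + complex.Im z ^+ 2.
Proof. by rewrite normc_sqrtE sqr_sqrtr// addr_ge0// sqr_ge0. Qed.
Lemma Re_le_normc z : `|complex.Re z| <= nc z.
Proof. by rewrite normc_sqrtE -sqrtr_sqr ler_wsqrtr// lerDl sqr_ge0. Qed.
Lemma Im_le_normc z : `|complex.Im z| <= nc z.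
Proof. by rewrite normc_sqrtE -sqrtr_sqr ler_wsqrtr// lerDr sqr_ge0. Qed.
Lemma normc_le_ReIm z : nc z <= `|complex.Re z| + `|complex.Im z|.
Proof.
rewrite -(@ler_pXn2r _ 2) ?nnegrE ?normc_ge0 ?addr_ge0// sqr_normc sqrrD.
rewrite !real_normK ?num_real//.
have := mulr_ge0 (normr_ge0 (complex.Re z)) (normr_ge0 (complex.Im z)); lra.
Qed.
Lemma normc_distC z w : nc (z - w) = nc (w - z).
Proof. by rewrite -normcN opprB. Qed.
Lemma normc_eq0 z : (nc z == 0) = (z == 0).
Proof. by apply/eqP/eqP => [/eq0_normc|->]; rewrite ?normc0. Qed.
Lemma normc_gt0 z : (0 < nc z) = (z != 0).
Proof. by rewrite lt_neqAle normc_ge0 andbT eq_sym normc_eq0. Qed.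

(* [R[i]^o] is normed over [R[i]], so a derivative along [1] is a complex one. *)
Definition cdiff f z := derivable (f : R[i]^o -> R[i]^o) z 1.

Definition ccont f z := forall e : R, 0 < e -> exists2 d : R, 0 < d &
  forall w, nc w < d -> nc (f (z + w) - f z) < e.

Lemma complex_differentiable_cdiff f z : complex_differentiable f z -> cdiff f z.
Proof.
move=> [l Hl]; apply/cvg_ex; exists l.
apply: cvg_trans Hl; apply: near_eq_cvg; near=> w => /=.
rewrite [w *: 1]mulr1 [w + z]addrC /GRing.scale/= mulrC//.
Unshelve. all: by end_near. Qed.

Lemma cdiff_expand f z : cdiff f z -> exists l : C, forall e : R, 0 < e ->
  exists2 d : R, 0 < d & forall w, nc w < d -> nc (f (z + w) - f z - l * w) <= e * nc w.
Proof.
move=> /cvg_ex[l /cvgrPdist_lt Hl]; exists l => e e0.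
have eC : (0 : C) < e%:C%C by rewrite ltcR.
have := Hl _ eC; rewrite -nbhs_nearE.
move=> /nbhs_ballP[d /= d0 Hd].
have dE : d = (complex.Re d)%:C%C by rewrite RRe_real// gtr0_real.
have d0' : 0 < complex.Re d by move: d0; rewrite {1}dE ltcR.
exists (complex.Re d) => // w wd.
have [->|w0] := eqVneq w 0; first by rewrite addr0 mulr0 subrr subr0 normc0 mulr0.
have := Hd w; rewrite /ball /= sub0r normrN => /(_ _ w0).
rewrite {1}dE [`|w|](_ : _ = (nc w)%:C%C)// ltcR => /(_ wd).
rewrite [X in X < _](_ : _ = (nc (l - w^-1 * (f (w * 1 + z) - f z)))%:C%C)//.
rewrite ltcR mulr1 [w + z]addrC => H.
have -> : f (z + w) - f z - l * w = - ((l - w^-1 * (f (z + w) - f z)) * w).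
  by field.
by rewrite normcN normcM ler_wpM2r ?normc_ge0// ltW.
Qed.

Lemma cdiff_ccont f z : cdiff f z -> ccont f z.
Proof.
move=> /cdiff_expand[l Hl] e e0; have [d d0 Hd] := Hl _ ltr01.
have p : 0 < nc l + 2 by rewrite ltr_wpDl ?normc_ge0.
exists (Num.min d (e / (nc l + 2))); first by rewrite lt_min d0 divr_gt0.
move=> w; rewrite lt_min ltr_pdivlMr// => /andP[wd we].
have -> : f (z + w) - f z = f (z + w) - f z - l * w + l * w by ring.
apply: (le_lt_trans (le_normcD _ _)); apply: (le_lt_trans (lerD (Hd w wd) (lexx _))).
by apply: le_lt_trans we; rewrite normcM; have := normc_ge0 w; lra.
Qed.

Lemma cdiff_cst (c : C) z : cdiff (fun=> c) z.
Proof. exact: derivable_cst. Qed.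
Lemma cdiff_id z : cdiff (fun w => w) z.
Proof. exact: derivable_id. Qed.
Lemma cdiffD f k z : cdiff f z -> cdiff k z -> cdiff (fun w => f w + k w) z.
Proof. exact: derivableD. Qed.
Lemma cdiffB f k z : cdiff f z -> cdiff k z -> cdiff (fun w => f w - k w) z.
Proof. exact: derivableB. Qed.
Lemma cdiffM f k z : cdiff f z -> cdiff k z -> cdiff (fun w => f w * k w) z.
Proof. exact: derivableM. Qed.
Lemma cdiffV f z : f z != 0 -> cdiff f z -> cdiff (fun w => (f w)^-1) z.
Proof. by move=> f0 df; apply: derivableV. Qed.

Lemma ccontM f k z : ccont f z -> ccont k z -> ccont (fun w => f w * k w) z.
Proof.
move=> cf ck e e0.
pose M := nc (f z) + nc (k z) + 1.
have M0 : 0 < M by rewrite ltr_wpDl// addr_ge0// normc_ge0.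
pose e' := Num.min 1 (e / (2 * M)).
have e'0 : 0 < e' by rewrite lt_min ltr01 divr_gt0// mulr_gt0.
have [d1 d10 H1] := cf _ e'0; have [d2 d20 H2] := ck _ e'0.
exists (Num.min d1 d2) => [|w]; first by rewrite lt_min d10.
rewrite lt_min => /andP[/H1 h1 /H2 h2].
have -> : f (z + w) * k (z + w) - f z * k z =
  (f (z + w) - f z) * (k (z + w) - k z) +
  ((f (z + w) - f z) * k z + f z * (k (z + w) - k z)) by ring.
apply: (le_lt_trans (le_normcD _ _)); rewrite normcM.
apply: (le_lt_trans (lerD (lexx _) (le_normcD _ _))); rewrite !normcM.
have h3 : nc (f (z + w) - f z) < 1 by rewrite (lt_le_trans h1)// ge_min lexx.
have h4 : e' * M <= e / 2.
  rewrite -ler_pdivlMr// (_ : e / 2 / M = e / (2 * M)); last by rewrite invfM mulrA.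
  by rewrite ge_min lexx orbT.
have a1 : nc (f (z + w) - f z) * nc (k (z + w) - k z) <= e'.
  apply: (le_trans (ler_wpM2r (normc_ge0 _) (ltW h3))).
  by rewrite mul1r ltW.
have a2 := ler_wpM2r (normc_ge0 (k z)) (ltW h1).
have a3 := ler_wpM2l (normc_ge0 (f z)) (ltW h2).
have : e' * M = e' + e' * nc (k z) + nc (f z) * e' by rewrite /M; ring.
lra.
Qed.

Lemma ccontD f k z : ccont f z -> ccont k z -> ccont (fun w => f w + k w) z.
Proof.
move=> cf ck e e0; have e2 : 0 < e / 2 by rewrite divr_gt0.
have [d1 d10 H1] := cf _ e2; have [d2 d20 H2] := ck _ e2.
exists (Num.min d1 d2) => [|w]; first by rewrite lt_min d10.
rewrite lt_min => /andP[/H1 h1 /H2 h2].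
have -> : f (z + w) + k (z + w) - (f z + k z) =
  (f (z + w) - f z) + (k (z + w) - k z) by ring.
apply: (le_lt_trans (le_normcD _ _)); lra.
Qed.

Lemma cdiff_eq f k z d : 0 < d -> (forall w, nc (w - z) < d -> f w = k w) ->
  cdiff f z -> cdiff k z.
Proof.
move=> d0 fk; apply: near_eq_derivable; apply/nbhs_ballP.
exists (d%:C)%C => [|w]; first by rewrite /= ltcR.
rewrite /ball /= [`|_|](_ : _ = (nc (z - w))%:C%C)// ltcR => zw.
by rewrite fk// normc_distC.
Qed.

End ComplexCalculus.

#[local] Opaque cdiff.

Section DifferenceQuotient.
Variable R : realType.
Local Notation C := R[i].
Local Notation nc := (@normc R).
Implicit Types (f : C -> C) (z w : C).

(* [l] is the value at the removable point [z0]. *)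
Definition dslope f (z0 : C) (l : C) w := if w == z0 then l else (f w - f z0) / (w - z0).

Lemma dslopeE f z0 l w : w != z0 -> dslope f z0 l w = (f w - f z0) / (w - z0).
Proof. by rewrite /dslope => /negbTE ->. Qed.

Lemma cdiff_dslope f z0 l z : z != z0 -> cdiff f z -> cdiff (dslope f z0 l) z.
Proof.
move=> zz0 df; apply: (@cdiff_eq _ (fun w => (f w - f z0) / (w - z0)) _ _ (nc (z - z0))).
- by rewrite normc_gt0 subr_eq0.
- move=> w wz; rewrite dslopeE//; apply: contraTneq wz => ->.
  by rewrite normc_distC ltxx.
- apply: (@cdiffM _ (fun w => f w - f z0) (fun w => (w - z0)^-1)).
    by apply: (@cdiffB _ f (fun=> f z0)); [exact: df|exact: cdiff_cst].
  apply: (@cdiffV _ (fun w => w - z0)); first by rewrite subr_eq0.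
  by apply: (@cdiffB _ (fun w => w) (fun=> z0)); [exact: cdiff_id|exact: cdiff_cst].
Qed.

Lemma ccont_dslope f z0 : cdiff f z0 -> exists l, ccont (dslope f z0 l) z0.
Proof.
move=> /cdiff_expand[l Hl]; exists l => e e0.
have [d d0 Hd] := Hl _ (divr_gt0 e0 (ltr0n _ 2)); exists d => // w /Hd.
have [->|w0] := eqVneq w 0; first by rewrite addr0 [X in _ -> normc X < _]subrr normc0.
have zw : z0 + w != z0 by rewrite -subr_eq0 addrAC subrr add0r.
have E0 : dslope f z0 l z0 = l by rewrite /dslope eqxx.
rewrite dslopeE// E0 [z0 + w - z0]addrAC subrr add0r => H.
have -> : (f (z0 + w) - f z0) / w - l = (f (z0 + w) - f z0 - l * w) / w by field.
rewrite normcM normcV ltr_pdivrMr ?normc_gt0//; apply: (le_lt_trans H).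
by rewrite ltr_pM2r ?normc_gt0//; lra.
Qed.

End DifferenceQuotient.

(** * Logarithmic polar coordinates and circle means *)

Section CircleMean.
Variable R : realType.
Local Notation C := R[i].
Local Notation nc := (@normc R).

Definition cexp (x y : R) : C := Complex (expR x * cos y) (expR x * sin y).

Lemma cexpD x y x' y' : cexp (x + x') (y + y') = cexp x y * cexp x' y'.
Proof.
apply/eqP; rewrite eq_complex /= expRD cosD sinD.
by apply/andP; split; apply/eqP; ring.
Qed.

Lemma normc_cexp x y : nc (cexp x y) = expR x.
Proof.
rewrite normc_sqrtE /= !exprMn -mulrDr cos2Dsin2 mulr1 sqrtr_sqr ger0_norm//.
Qed.

Lemma cexp2pi x y : cexp x (y + 2 * pi) = cexp x y.
Proof.
rewrite /cexp (_ : 2 * pi = pi *+ 2); last by rewrite mulr_natl.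
by rewrite cosD2pi sinD2pi.
Qed.

Lemma derive_expand (f : R -> R) (x l e : R) : is_derive x 1 f l -> 0 < e ->
  exists2 d : R, 0 < d & forall s, `|s| < d -> `|f (x + s) - f x - l * s| <= e * `|s|.
Proof.
move=> [/cvg_ex[l' Hl'] lE] e0.
have E : l' = l by rewrite -lE; apply/esym/cvg_lim.
rewrite E in Hl'; move/cvgrPdist_lt : Hl' => /(_ _ e0); rewrite -nbhs_nearE.
move=> /nbhs_ballP[d /= d0 Hd]; exists d => // s sd.
have [->|s0] := eqVneq s 0; first by rewrite addr0 mulr0 subrr subr0 normr0 mulr0.
have := Hd s; rewrite /ball /= sub0r normrN => /(_ sd s0).
rewrite /GRing.scale/= mulr1 [s + x]addrC => H.
have -> : f (x + s) - f x - l * s = - ((l - s^-1 * (f (x + s) - f x)) * s).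
  by field.
by rewrite normrN normrM ler_wpM2r// ltW.
Qed.

(** Differentiability of the exponential at the origin; [cexpD] carries it to every other point. *)
Lemma cexp_expand0 (e : R) : 0 < e -> exists2 d : R, 0 < d & forall s t, `|s| < d -> `|t| < d ->
  nc (cexp s t - 1 - Complex s t) <= e * (`|s| + `|t|).
Proof.
move=> e0; pose e' := Num.min 1 (e / 6).
have e'0 : 0 < e' by rewrite lt_min ltr01 divr_gt0.
have e'1 : e' <= 1 by rewrite ge_min lexx.
have e'e : e' <= e / 6 by rewrite ge_min lexx orbT.
have [d1 d10 H1] := derive_expand (is_derive_expR (0 : R)) e'0.
have [d2 d20 H2] := derive_expand (is_derive_cos (0 : R)) e'0.
have [d3 d30 H3] := derive_expand (is_derive_sin (0 : R)) e'0.
exists (Num.min (Num.min d1 (e' / 2)) (Num.min d2 d3)).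
  by rewrite !lt_min d10 d20 d30 divr_gt0.
move=> s t; rewrite !lt_min => /andP[/andP[sd1 s2] _] /andP[_ /andP[td2 td3]].
have h1 : `|expR s - 1 - s| <= e' * `|s|.
  by have := H1 s sd1; rewrite add0r expR0 mul1r.
have h2 : `|cos t - 1| <= e' * `|t|.
  by have := H2 t td2; rewrite add0r cos0 sin0 oppr0 mul0r subr0.
have h3 : `|sin t - t| <= e' * `|t|.
  by have := H3 t td3; rewrite add0r cos0 sin0 mul1r subr0.
have hs : `|expR s - 1| <= e'.
  have -> : expR s - 1 = expR s - 1 - s + s by ring.
  apply: (le_trans (ler_normD _ _)).
  apply: (le_trans (lerD h1 (lexx _))).
  by have := ler_piMl (normr_ge0 s) e'1; lra.
have es : `|expR s| <= 2.
  have -> : expR s = expR s - 1 + 1 by ring.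
  by apply: (le_trans (ler_normD _ _)); rewrite normr1; lra.
apply: (le_trans (normc_le_ReIm _)) => /=.
have -> : expR s * cos t - 1 - s = expR s * (cos t - 1) + (expR s - 1 - s) by ring.
have -> : expR s * sin t - 0 - t = expR s * (sin t - t) + t * (expR s - 1) by ring.
have a1 : `|expR s * (cos t - 1) + (expR s - 1 - s)| <= 2 * (e' * `|t|) + e' * `|s|.
  rewrite (le_trans (ler_normD _ _))// lerD//.
  by rewrite normrM ler_pM.
have a2 : `|expR s * (sin t - t) + t * (expR s - 1)| <= 2 * (e' * `|t|) + `|t| * e'.
  rewrite (le_trans (ler_normD _ _))// lerD//; last by rewrite normrM ler_wpM2l.
  by rewrite normrM ler_pM.
have a3 := ler_wpM2r (normr_ge0 t) e'e; have a4 := ler_wpM2r (normr_ge0 s) e'e.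
have p1 : 0 <= e * `|s| by rewrite mulr_ge0// ltW.
have p2 : 0 <= e * `|t| by rewrite mulr_ge0// ltW.
lra.
Qed.
End CircleMean.

Section PolarMap.
Variable R : realType.
Local Notation C := R[i].
Local Notation nc := (@normc R).
Local Notation mu := (@lebesgue_measure R).
Implicit Types (k : C -> C) (c w : C).

Lemma polar_expand c x y (e : R) : 0 < e -> exists2 d : R, 0 < d &
  forall x' y', `|x' - x| < d -> `|y' - y| < d ->
  nc (c * cexp x' y' - c * cexp x y - c * cexp x y * Complex (x' - x) (y' - y))
    <= e * (`|x' - x| + `|y' - y|).
Proof.
move=> e0; set r := nc (c * cexp x y).
have r0 : 0 < r + 1 by rewrite ltr_wpDl ?normc_ge0.
have [d d0 Hd] := cexp_expand0 (divr_gt0 e0 r0).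
exists d => // x' y' /Hd{}Hd /Hd{}Hd.
have -> : cexp x' y' = cexp x y * cexp (x' - x) (y' - y).
  by rewrite -cexpD; congr cexp; ring.
have -> : c * (cexp x y * cexp (x' - x) (y' - y)) - c * cexp x y -
   c * cexp x y * Complex (x' - x) (y' - y) =
   c * cexp x y * (cexp (x' - x) (y' - y) - 1 - Complex (x' - x) (y' - y)) by ring.
rewrite normcM -/r; apply: (le_trans (ler_wpM2l _ Hd)); first exact: normc_ge0.
rewrite mulrA ler_wpM2r ?addr_ge0// mulrCA ler_piMr ?(ltW e0)//.
by rewrite ler_pdivrMr// mul1r lerDl.
Qed.

Lemma polar_close c x y (e : R) : 0 < e -> exists2 d : R, 0 < d &
  forall x' y', `|x' - x| < d -> `|y' - y| < d ->
  nc (c * cexp x' y' - c * cexp x y) <= (nc (c * cexp x y) + 1) * (`|x' - x| + `|y' - y|)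
  /\ nc (c * cexp x' y' - c * cexp x y) < e.
Proof.
move=> e0; set r := nc (c * cexp x y).
have r0 : 0 < r + 1 by rewrite ltr_wpDl ?normc_ge0.
have [d d0 Hd] := polar_expand c x y ltr01.
exists (Num.min d (e / (2 * (r + 1)))).
  by rewrite lt_min d0 divr_gt0// mulr_gt0.
move=> x' y'; rewrite !lt_min => /andP[xd xe] /andP[yd ye].
have H := Hd _ _ xd yd.
have H1 : nc (c * cexp x' y' - c * cexp x y) <= (r + 1) * (`|x' - x| + `|y' - y|).
  have -> : c * cexp x' y' - c * cexp x y = c * cexp x y * Complex (x' - x) (y' - y) +
    (c * cexp x' y' - c * cexp x y - c * cexp x y * Complex (x' - x) (y' - y)) by ring.
  rewrite (le_trans (le_normcD _ _))// mulrDl lerD// normcM -/r.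
  by rewrite ler_wpM2l ?normc_ge0// normc_le_ReIm.
split => //; apply: (le_lt_trans H1).
rewrite mulrC -ltr_pdivlMr//.
have : e / (r + 1) = e / (2 * (r + 1)) + e / (2 * (r + 1)).
  by field; rewrite gt_eqF.
lra.
Qed.

Lemma conformal_polar k c x y : cdiff k (c * cexp x y) ->
  conformal_at (fun x y => complex.Re (k (c * cexp x y)))
               (fun x y => complex.Im (k (c * cexp x y))) x y.
Proof.
move=> /cdiff_expand[l Hl]; set p := c * cexp x y in Hl *.
(* Chain rule: [c * cexp] is its own derivative, so the composite has derivative [l * p]. *)
exists (complex.Re (l * p)), (complex.Im (l * p)) => e e0.
set r := nc p.
have r0 : 0 < r + 1 by rewrite ltr_wpDl ?normc_ge0.
have l0 : 0 < nc l + 1 by rewrite ltr_wpDl ?normc_ge0.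
have e1 : 0 < e / (2 * (r + 1)) by rewrite divr_gt0// mulr_gt0.
have e2 : 0 < e / (2 * (nc l + 1)) by rewrite divr_gt0// mulr_gt0.
have [d1 d10 H1] := Hl _ e1.
have [d2 d20 H2] := polar_close c x y d10.
have [d3 d30 H3] := polar_expand c x y e2.
exists (Num.min d2 d3); first by rewrite lt_min d20.
move=> x' y'; rewrite !lt_min => /andP[x2 x3] /andP[y2 y3].
have {H2}[h2 h2'] := H2 _ _ x2 y2; have {H3}h3 := H3 _ _ x3 y3.
rewrite -/p in h2 h2' h3; set p' := c * cexp x' y' in h2 h2' h3 *.
have := H1 _ h2'; rewrite addrCA subrr addr0 => h1.
set s := Complex (x' - x) (y' - y) in h3.
have key : nc (k p' - k p - l * p * s) <= e * (`|x' - x| + `|y' - y|).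
  have -> : k p' - k p - l * p * s =
    (k p' - k p - l * (p' - p)) + l * (p' - p - p * s) by ring.
  apply: (le_trans (le_normcD _ _)).
  have a1 := le_trans h1 (ler_wpM2l (ltW e1) h2).
  have a2 : nc (l * (p' - p - p * s)) <= e / 2 * (`|x' - x| + `|y' - y|).
    rewrite normcM; apply: (le_trans (ler_wpM2l (normc_ge0 _) h3)).
    rewrite mulrA ler_wpM2r ?addr_ge0// mulrA ler_pdivrMr ?mulr_gt0//.
    have := mulr_ge0 (ltW e0) (normc_ge0 l); lra.
  apply: (le_trans (lerD a1 a2)); rewrite -/r mulrA.
  have -> : e / (2 * (r + 1)) * (r + 1) = e / 2 by field; rewrite gt_eqF.
  by rewrite -mulrDl -splitr.
split; apply: le_trans key.
  rewrite (_ : _ - _ = complex.Re (k p' - k p - l * p * s)); first exact: Re_le_normc.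
  by rewrite /s; case: (k p') => ? ?; case: (k p) => ? ?; case: (l * p).
rewrite (_ : _ - _ = complex.Im (k p' - k p - l * p * s)); first exact: Im_le_normc.
rewrite /s; case: (k p') => ? ?; case: (k p) => ? ?; case: (l * p) => ? ? /=.
by ring.
Qed.

Lemma polar_Re_close k c x y (e : R) : 0 < e -> ccont k (c * cexp x y) ->
  exists2 d : R, 0 < d & forall x' y', `|x' - x| < d -> `|y' - y| < d ->
  `|complex.Re (k (c * cexp x' y')) - complex.Re (k (c * cexp x y))| < e.
Proof.
move=> e0 /(_ _ e0)[d1 d10 H1].
have [d d0 Hd] := polar_close c x y d10; exists d => // x' y' hx hy.
have [_ /H1] := Hd _ _ hx hy; rewrite addrCA subrr addr0; apply: le_lt_trans.
have -> : complex.Re (k (c * cexp x' y')) - complex.Re (k (c * cexp x y)) =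
  complex.Re (k (c * cexp x' y') - k (c * cexp x y)).
  by case: (k (c * cexp x y)); case: (k (c * cexp x' y')).
exact: Re_le_normc.
Qed.

(** Not divided by [2 * pi]. The circle has radius [nc c * expR x], so [x] is a logarithmic radius
    relative to the point [c], and the angle is measured from [c]. *)
Definition circle_mean k c x :=
  (\int[mu]_(y in `[(0 : R), 2 * pi]) complex.Re (k (c * cexp x y)))%R.

Lemma twopi_ge0 : 0 <= 2 * pi :> R.
Proof. by rewrite mulr_ge0// pi_ge0. Qed.

Lemma polar_Re_continuous k c x y : ccont k (c * cexp x y) ->
  {for y, continuous (fun y => complex.Re (k (c * cexp x y)))}.
Proof.
move=> kc; apply/cvgrPdist_lt => e e0.
have [d d0 Hd] := polar_Re_close e0 kc; near=> t; rewrite distrC.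
apply: Hd; first by rewrite subrr normr0.
by rewrite distrC; near: t; exact: cvgr_dist_lt.
Unshelve. all: by end_near. Qed.

(** In logarithmic coordinates the annulus is a rectangle of height [2 * pi]. Its horizontal sides
    carry the same integral by periodicity, so Goursat equates the two vertical ones, which are the
    circle integrals. *)
Lemma circle_mean_eq k c a b : a <= b ->
  (forall x y, a <= x <= b -> cdiff k (c * cexp x y)) ->
  circle_mean k c a = circle_mean k c b.
Proof.
move=> ab dk; apply/esym/eqP; rewrite -subr_eq0; apply/eqP.
rewrite /circle_mean (Goursat_rectangle (A := fun x y => complex.Re (k (c * cexp x y)))
  (B := fun x y => complex.Im (k (c * cexp x y))) ab twopi_ge0); last first.
  by move=> x y hx _; apply: conformal_polar; exact: dk.
rewrite (_ : (fun x => _) = (fun x => complex.Im (k (c * cexp x 0)))) ?subrr//.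
by apply/funext => x; rewrite -[2 * pi]add0r cexp2pi.
Qed.

Lemma circle_mean_close k c x K (M : R) : (forall y, ccont k (c * cexp x y)) ->
  (forall y, 0 <= y <= 2 * pi -> `|complex.Re (k (c * cexp x y)) - K| <= M) ->
  `|circle_mean k c x - 2 * pi * K| <= M * (2 * pi).
Proof.
move=> kc H; rewrite [_ * K]mulrC -[X in K * X]subr0 -[X in M * X]subr0.
by apply: Rintegral_segment_le => // [|y _]; [exact: twopi_ge0|exact: polar_Re_continuous].
Qed.

Lemma circle_mean_continuous k c x0 (e d0 : R) : 0 < e -> 0 < d0 ->
  (forall x y, `|x - x0| < d0 -> ccont k (c * cexp x y)) ->
  exists2 d : R, 0 < d & forall x, `|x - x0| < d ->
    `|circle_mean k c x - circle_mean k c x0| <= e.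
Proof.
move=> e0 d00 kc; pose e' := e / (2 * pi + 1).
have p0 : 0 < 2 * pi + 1 :> R by rewrite ltr_wpDl// twopi_ge0.
have e'0 : 0 < e' by rewrite divr_gt0.
(* Compactness of the range of angles makes the continuity in the radius uniform in the angle. *)
have := (compact_near_coveringP `[(0 : R), 2 * pi]).1 (@segment_compact _ _ _).
move=> /(_ R (nbhs x0) (fun x y => `|complex.Re (k (c * cexp x y)) -
   complex.Re (k (c * cexp x0 y))| < e') (nbhs_filter _)).
case.
  move=> y _; have kcy : ccont k (c * cexp x0 y) by apply: kc; rewrite subrr normr0.
  have [d1 d10 H1] := polar_Re_close (divr_gt0 e'0 (ltr0n R 2)) kcy.
  exists (ball y d1, ball x0 d1); first by split; apply: nbhsx_ballx.
  move=> [y' x'] [/=]; rewrite /ball/= => hy hx.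
  have a1 := H1 x' y'; rewrite distrC in hx; rewrite distrC in hy.
  have := a1 hx hy; have := H1 x0 y'; rewrite subrr normr0 => /(_ d10 hy) h2 h1.
  rewrite (_ : _ - _ = (complex.Re (k (c * cexp x' y')) - complex.Re (k (c * cexp x0 y))) -
     (complex.Re (k (c * cexp x0 y')) - complex.Re (k (c * cexp x0 y)))); last by ring.
  by apply: (le_lt_trans (ler_normB _ _)); rewrite [ltRHS](splitr e') ltrD.
move=> d /= d1 Hd; exists (Num.min d d0); first by rewrite lt_min d1.
move=> x; rewrite lt_min => /andP[xd xd0].
have cx y : ccont k (c * cexp x y) by exact: kc.
have cx0 y : ccont k (c * cexp x0 y) by apply: kc; rewrite subrr normr0.
have := Hd x; rewrite /= distrC => /(_ xd) H.
rewrite /circle_mean -RintegralB//; last 2 first.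
- by apply: integrable_segment => y _; exact: polar_Re_continuous.
- by apply: integrable_segment => y _; exact: polar_Re_continuous.
have := @Rintegral_segment_le R (fun y => complex.Re (k (c * cexp x y)) -
  complex.Re (k (c * cexp x0 y))) 0 (2 * pi) 0 e' twopi_ge0.
rewrite mul0r !subr0 => H'; apply: (le_trans (H' _ _)).
- by move=> y _; apply: cvgB; exact: polar_Re_continuous.
- by move=> y hy; rewrite subr0 ltW//; apply: H; rewrite /= in_itv.
- by rewrite /e' mulrAC ler_pdivrMr// ler_wpM2l ?(ltW e0)// lerDl.
Qed.

Lemma normc_polar c x y : nc (c * cexp x y) = nc c * expR x.
Proof. by rewrite normcM normc_cexp. Qed.

Lemma dist_chain (m0 m1 m2 K E e : R) : `|m2 - K| <= E -> `|m0 - m1| <= e ->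
  `|m2 - m1| <= e -> `|m0 - K| <= E + e * 2.
Proof. by rewrite !ler_norml; lra. Qed.

(* Goursat makes the mean independent of the radius away from the circle
   through [w0]; continuity carries it across that circle, so no
   differentiability at [w0] is needed. *)
Lemma circle_mean_value k c w0 : 0 < nc c -> nc w0 < nc c ->
  (forall z, nc z <= nc c -> ccont k z) ->
  (forall z, nc z <= nc c -> z != w0 -> cdiff k z) ->
  circle_mean k c 0 = 2 * pi * complex.Re (k 0).
Proof.
move=> c0 wc kc kd.
have ncle x y : x <= 0 -> nc (c * cexp x y) <= nc c.
  by move=> x0; rewrite normc_polar ler_piMr ?normc_ge0// expR_le1.
have p0 : 0 <= 2 * pi :> R by exact: twopi_ge0.
(* As [x] decreases the circles shrink to the origin, where [k] is continuous. *)
have left_close e : 0 < e -> exists x1, forall x, x <= x1 ->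
    x <= 0 -> `|circle_mean k c x - 2 * pi * complex.Re (k 0)| <= e * (2 * pi).
  move=> e0; have [d d0 Hd] := kc 0 (eq_ind_r (fun t => t <= nc c) (normc_ge0 c) (normc0 _)) _ e0.
  exists (ln (d / (2 * nc c))) => x x1 xle.
  apply: circle_mean_close => [y|y _]; first by apply: kc; exact: ncle.
  have -> : complex.Re (k (c * cexp x y)) - complex.Re (k 0) =
    complex.Re (k (c * cexp x y) - k 0).
    by case: (k 0); case: (k (c * cexp x y)).
  apply: (le_trans (Re_le_normc _)).
  have := Hd (c * cexp x y); rewrite add0r => H; apply/ltW/H.
  rewrite normc_polar.
  have : expR x <= d / (2 * nc c).
    by rewrite -[leRHS]lnK ?ler_expR// posrE divr_gt0// mulr_gt0.
  move=> /(ler_wpM2l (ltW c0)) /le_lt_trans; apply.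
  rewrite invfM mulrCA [X in _ * X]mulrCA divff ?gt_eqF// mulr1.
  by rewrite ltr_pdivrMr//; lra.
have seg a b : a <= b -> b <= 0 -> (forall x, a <= x <= b -> nc c * expR x != nc w0) ->
    circle_mean k c a = circle_mean k c b.
  move=> ab b0 H; apply: circle_mean_eq => // x y hx.
  have [_ xb] := andP hx; apply: kd; first by apply: ncle; exact: le_trans b0.
  by apply: contraNneq (H x hx) => <-; rewrite normc_polar.
suff H e : 0 < e -> `|circle_mean k c 0 - 2 * pi * complex.Re (k 0)| <= e * (2 * pi) + e * 2.
  apply/eqP; rewrite -subr_eq0 -normr_eq0 eq_le normr_ge0 andbT.
  apply/ler_addgt0Pr => e e0; rewrite add0r.
  have q0 : 0 < 2 * pi + 2 :> R by rewrite ltr_wpDl.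
  have := H _ (divr_gt0 e0 q0); rewrite -mulrDr divfK// gt_eqF//.
move=> e0; have [x1 Hx1] := left_close e e0.
(* If [w0] is the origin, no circle passes through it and all radii are linked directly. Otherwise
   [x0] is the logarithmic radius of the circle through [w0], and the means at [x0 - t] and [x0 + t]
   are compared with the one at [x0]. *)
have [w00|w0n] := eqVneq w0 0.
  have := Hx1 (Num.min x1 0); rewrite !ge_min !lexx orbT => /(_ isT isT).
  rewrite (seg _ 0) ?ge_min ?lexx ?orbT//; last first.
    by move=> x _; rewrite w00 normc0 mulf_neq0// gt_eqF// expR_gt0.
  move=> /le_trans; apply; rewrite lerDl mulr_ge0// ltW//.
have nw0 : 0 < nc w0 by rewrite normc_gt0.
pose x0 := ln (nc w0 / nc c).
have q0 : 0 < nc w0 / nc c by rewrite divr_gt0.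
have x0lt : x0 < 0 by rewrite -ln1 ltr_ln ?posrE// ltr_pdivrMr// mul1r.
have expx0 x : nc c * expR x = nc w0 -> x = x0.
  move=> H; apply: expR_inj; rewrite /x0 lnK ?posrE//.
  by rewrite -H mulrAC divff ?gt_eqF// mul1r.
have x0n0 : 0 < - x0 by rewrite oppr_gt0.
have kx0 x y : `|x - x0| < - x0 -> ccont k (c * cexp x y).
  move=> hx; apply: kc; apply: ncle.
  by move: hx; rewrite ltr_norml => /andP[_]; lra.
have [d d0 Hd] := circle_mean_continuous e0 x0n0 kx0.
have [t [t0 td tx]] : exists t, [/\ 0 < t, t < d & t <= - x0].
  exists (Num.min (d / 2) (- x0)); split; first by rewrite lt_min divr_gt0.
    by rewrite gt_min ltr_pdivrMr// ltr_pMr// ltr1n.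
  by rewrite ge_min lexx orbT.
have A1 : `|circle_mean k c (x0 + t) - circle_mean k c x0| <= e.
  by apply: Hd; rewrite addrAC subrr add0r gtr0_norm.
have A2 : `|circle_mean k c (x0 - t) - circle_mean k c x0| <= e.
  by apply: Hd; rewrite addrAC subrr add0r normrN gtr0_norm.
have B1 : circle_mean k c (x0 + t) = circle_mean k c 0.
  apply: seg => //; first by rewrite -lerBrDl sub0r.
  move=> x /andP[h1 _]; apply/eqP => /expx0 E; move: h1.
  by rewrite E gerDl leNgt t0.
have [x2 [x21 x2t]] : exists x2, x2 <= x1 /\ x2 <= x0 - t.
  exists (Num.min x1 (x0 - t)).
  by split; rewrite ge_min lexx ?orbT.
have x0t : x0 - t < x0 by rewrite gtrBl.
have x0t0 : x0 - t <= 0 by exact: le_trans (ltW x0t) (ltW x0lt).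
have B2 : circle_mean k c x2 = circle_mean k c (x0 - t).
  apply: seg; [exact: x2t|exact: x0t0|] => x /andP[_ h1].
  by apply/eqP => /expx0 E; move: h1; rewrite E leNgt x0t.
have A3 := Hx1 x2 x21 (le_trans x2t x0t0).
rewrite B2 in A3; rewrite B1 in A1.
exact: dist_chain A3 A1 A2.
Qed.
End PolarMap.

Section Poisson.
Variable R : realType.
Local Notation C := R[i].
Local Notation nc := (@normc R).
Local Notation mu := (@lebesgue_measure R).
Local Notation "x ^*" := (conjc x) : ring_scope.
Implicit Types (g : C -> C) (c w z : C).

Definition poisson_kernel (r : R) w z := (r ^+ 2 - nc w ^+ 2) / nc (z - w) ^+ 2.

Lemma mulcJ_normc z : z * z^* = (nc z ^+ 2)%:C%C.
Proof.
rewrite sqr_normc; case: z => a b /=; apply/eqP; rewrite eq_complex /=.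
by apply/andP; split; apply/eqP; ring.
Qed.

Lemma Re_realM (a : R) z : complex.Re (a%:C%C * z) = a * complex.Re z.
Proof. by case: z => x y /=; rewrite mul0r subr0. Qed.

Lemma ReD z w : complex.Re (z + w) = complex.Re z + complex.Re w.
Proof. by case: z; case: w. Qed.

Lemma conjcB z w : (z - w)^* = z^* - w^*.
Proof. by rewrite rmorphB. Qed.
Lemma conjcM z w : (z * w)^* = z^* * w^*.
Proof. by rewrite rmorphM. Qed.
Lemma normcJ z : nc z^* = nc z.
Proof. by case: z => a b /=; rewrite sqrrN. Qed.

(* Differentiable on the closed disc of radius [r] except at [w]; its real part
   is [poisson_kernel r w z * Re (g z)] for [|z| = r], and its value at [0] is
   the conjugate of [g w]. *)
Definition poisson_extension g (r : R) w l z :=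
  z * dslope g w l z + (g z * (w^* * z) + (g w)^* * (r ^+ 2)%:C%C) * ((r ^+ 2)%:C%C - w^* * z)^-1.

Lemma poisson_extension_den (r : R) w z : nc w < r -> nc z <= r ->
  (r ^+ 2)%:C%C - w^* * z != 0.
Proof.
move=> wr zr; rewrite subr_eq0; apply/eqP => H.
have r0 : 0 < r by exact: le_lt_trans (normc_ge0 _) wr.
have := congr1 nc H; rewrite normcM normcJ.
rewrite [LHS](_ : _ = r ^+ 2); last first.
  by rewrite normc_sqrtE /= expr0n addr0 sqrtr_sqr ger0_norm// exprn_ge0// ltW.
apply/eqP; rewrite gt_eqF// expr2; apply: (@le_lt_trans _ _ (nc w * r)).
  by rewrite ler_wpM2l// normc_ge0.
by rewrite ltr_pM2r.
Qed.

Lemma Re_poisson_extension g (r : R) w l z : nc z = r -> nc w < r ->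
  complex.Re (poisson_extension g r w l z) = poisson_kernel r w z * complex.Re (g z).
Proof.
move=> zr wr.
have zw : z - w != 0 by apply: contraTneq wr => /subr0_eq <-; rewrite zr ltxx.
have zwJ : z^* - w^* != 0 by rewrite -conjcB conjc_eq0.
have z0 : z != 0.
  by rewrite -normc_gt0 zr (le_lt_trans _ wr)// normc_ge0.
have zJ : z * z^* = (r ^+ 2)%:C%C by rewrite mulcJ_normc zr.
pose X := g w * z / (z - w).
have XJ : X^* = (g w)^* * z^* / (z^* - w^*) by rewrite /X !conjcM conjc_inv conjcB.
have PE : (poisson_kernel r w z)%:C%C = (z * z^* - w * w^*) / ((z - w) * (z^* - w^*)).
  rewrite -conjcB !mulcJ_normc zr /poisson_kernel.
  by rewrite -rmorphB -fmorphV -rmorphM.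
(* On the circle [r ^+ 2] is [z * z^*]. The terms in [g z] then combine to the kernel, and those in
   [g w] to [X^* - X], which is purely imaginary. *)
have -> : poisson_extension g r w l z = (poisson_kernel r w z)%:C%C * g z + (X^* - X).
  rewrite PE XJ /X /poisson_extension dslopeE; last by rewrite -subr_eq0.
  rewrite -zJ; field; rewrite ?zw ?zwJ ?z0 ?andbT//=.
  by rewrite (_ : _ - _ = z * (z^* - w^*)) ?mulf_neq0//; ring.
by rewrite ReD Re_realM [X in _ + X](_ : _ = 0) ?addr0//; case: (X) => a b /=; rewrite subrr.
Qed.

(** The mean value property of [poisson_extension], which is only known to be continuous at [w]. The
    circle is given by a point [c] on it, so that the integral later reads as one over the rotations
    of a fixed point. *)
Lemma poisson_formula g c w : nc c < 1 -> nc w < nc c ->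
  (forall z, nc z < 1 -> cdiff g z) ->
  mu.-integrable `[(0 : R), 2 * pi] (EFin \o
     (fun y => poisson_kernel (nc c) w (c * cexp 0 y) * complex.Re (g (c * cexp 0 y)))) /\
  (\int[mu]_(y in `[(0 : R), 2 * pi])
     (poisson_kernel (nc c) w (c * cexp 0 y) * complex.Re (g (c * cexp 0 y))))%R
  = 2 * pi * complex.Re (g w).
Proof.
move=> c1 wc dg.
have w1 : nc w < 1 by exact: lt_trans c1.
have c0 : 0 < nc c by exact: le_lt_trans (normc_ge0 _) wc.
have [l cl] := ccont_dslope (dg w w1).
set r := nc c in c1 wc c0 *.
pose G z := (g z * (w^* * z) + (g w)^* * (r ^+ 2)%:C%C) * ((r ^+ 2)%:C%C - w^* * z)^-1.
have dG z : nc z <= r -> cdiff G z.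
  move=> zr; have dz := dg z (le_lt_trans zr c1).
  have dwz : cdiff (fun z => w^* * z) z.
    by apply: (@cdiffM _ (fun=> w^*) (fun z => z)); [exact: cdiff_cst|exact: cdiff_id].
  apply: (@cdiffM _ (fun z => g z * (w^* * z) + (g w)^* * (r ^+ 2)%:C%C)
    (fun z => ((r ^+ 2)%:C%C - w^* * z)^-1)).
    apply: (@cdiffD _ (fun z => g z * (w^* * z)) (fun=> (g w)^* * (r ^+ 2)%:C%C)).
      exact: (@cdiffM _ g (fun z => w^* * z) z dz dwz).
    exact: cdiff_cst.
  apply: (@cdiffV _ (fun z => (r ^+ 2)%:C%C - w^* * z)).
    exact: poisson_extension_den.
  apply: (@cdiffB _ (fun=> (r ^+ 2)%:C%C) (fun z => w^* * z)); last exact: dwz.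
  exact: cdiff_cst.
have dS z : nc z <= r -> z != w -> cdiff (fun z => z * dslope g w l z) z.
  move=> zr zw; apply: (@cdiffM _ (fun z => z) (dslope g w l)); first exact: cdiff_id.
  by apply: cdiff_dslope => //; apply: dg; exact: le_lt_trans c1.
have cS z : nc z <= r -> ccont (fun z => z * dslope g w l z) z.
  move=> zr; have [->|zw] := eqVneq z w; last by apply: cdiff_ccont; exact: dS.
  by apply: (@ccontM _ (fun z => z)) => //; apply: cdiff_ccont; exact: cdiff_id.
have cE z : nc z <= r -> ccont (poisson_extension g r w l) z.
  by move=> zr; apply: ccontD; [exact: cS|exact: cdiff_ccont (dG _ zr)].
have rE y : nc (c * cexp 0 y) = r by rewrite normc_polar expR0 mulr1.
rewrite (_ : (fun y => _) =
    (fun y => complex.Re (poisson_extension g r w l (c * cexp 0 y)))); last first.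
  by apply/funext => y; rewrite Re_poisson_extension.
split.
  apply: integrable_segment => y _; apply: polar_Re_continuous.
  by apply: cE; rewrite rE.
have -> : complex.Re (g w) = complex.Re (poisson_extension g r w l 0).
  rewrite /poisson_extension mul0r !mulr0 subr0 !add0r mulfK; first by case: (g w).
  rewrite -[X in _ != X]/((0 : R)%:C%C) (inj_eq (@complexI _)).
  by rewrite expf_neq0// gt_eqF.
apply: (circle_mean_value c0 wc cE) => z zr zw.
apply: (@cdiffD _ (fun z => z * dslope g w l z) G); [exact: dS|exact: dG].
Qed.

End Poisson.

(** * Plane area *)

Section SigmaFinitePlane.
Variable R : realType.

Lemma product_measure_ysection d1 d2 (T1 : measurableType d1) (T2 : measurableType d2)
    (m1 : {sigma_finite_measure set T1 -> \bar R})
    (m2 : {sigma_finite_measure set T2 -> \bar R}) (S : set (T1 * T2)) :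
  measurable S -> (m1 \x m2)%E S = (\int[m2]_y m1 (ysection S y))%E.
Proof.
move=> mS; transitivity ((m1 \x^ m2)%E S); last by [].
by apply: product_measure_unique => // A B mA mB; exact: product_measure2E.
Qed.

Local Notation mu := (@lebesgue_measure R).
Local Notation mu2 := (@lebesgue_measure R \x @lebesgue_measure R)%E.
Local Notation RR := (measurableTypeR R).

Lemma plane_measure_sigma_finite : sigma_finite [set: RR * RR] mu2.
Proof.
have /sigma_finiteP[F [TF ndF Foo]] := sigma_finiteT mu.
exists (fun n => F n `*` F n) => [|k]; last first.
  have [mF Fk] := Foo k; split; first exact: measurableX.
  by rewrite product_measure1E// lte_mul_pinfty// ge0_fin_numE.
rewrite -setXTT TF predeqE => -[x y]; split.
  move=> [/= [n _ Fnx] [k _ Gky]]; exists (maxn n k) => //; split.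
    by move: x Fnx; exact/subsetPset/ndF/leq_maxl.
  by move: y Gky; exact/subsetPset/ndF/leq_maxr.
by move=> [n _ []/= ? ?]; split; exists n.
Qed.

(* A new head constant, because the library's sigma-finite instance on [\x] is
   shadowed by the one for products of probability measures. *)
Definition plane_measure : set (RR * RR) -> \bar R := mu2.

HB.instance Definition _ := Measure.copy plane_measure mu2.
HB.instance Definition _ := @Measure_isSigmaFinite.Build _ _ _ plane_measure
  plane_measure_sigma_finite.

Lemma plane_measure_prod (A B : set RR) : measurable A -> measurable B ->
  plane_measure (A `*` B) = (mu A * mu B)%E.
Proof. by move=> mA mB; rewrite /plane_measure product_measure1E. Qed.
End SigmaFinitePlane.
Arguments plane_measure {R}.

Section PlaneMeasure.
Variable R : realType.
Local Notation mu := (@lebesgue_measure R).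
Local Notation mu2 := (@plane_measure R).
Local Notation RR := (measurableTypeR R).

Lemma measurable_affine (r a : R) :
  measurable_fun [set: RR] ((fun x => r * x + a) : RR -> RR).
Proof. by apply: measurable_funD => //; exact: measurable_funM. Qed.

(** The image of the measure under the inverse affine map, suitably scaled, has the right value on
    intervals; uniqueness of Lebesgue measure extends this to all measurable sets. *)
Lemma lebesgue_measure_affine (r a : R) (A : set RR) : 0 < r -> measurable A ->
  (r%:E * mu [set x | A (r * x + a)%R] = mu A)%E.
Proof.
move=> r0 mA; pose f : RR -> RR := fun x => r * x + a.
have mf : measurable_fun [set: RR] f by exact: measurable_affine.
pose rr : {nonneg R} := NngNum (ltW r0).
pose m := measure_function_pushforward__canonical__measure_function_Measure mu mf.
transitivity (mscale rr m A); first by [].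
apply/esym; apply: lebesgue_measure_unique => // _ [[p q]] _ <-.
rewrite -[RHS]/(r%:E * mu (f @^-1` `]p, q]%classic))%E.
rewrite (_ : f @^-1` _ = `](p - a) / r, (q - a) / r]%classic); last first.
  apply/seteqP; split => x /=; rewrite !in_itv/= /f ltr_pdivrMr// ler_pdivlMr//.
    by move=> /andP[h1 h2]; apply/andP; split; rewrite ![x * r]mulrC; lra.
  by move=> /andP[h1 h2]; apply/andP; split; rewrite ![r * x]mulrC; lra.
rewrite !lebesgue_measure_itv/= !lte_fin ltr_pM2r ?invr_gt0// ltrD2r.
case: ifP => _; last by rewrite mule0.
rewrite -!EFinD -EFinM; congr (_%:E).
by field; rewrite gt_eqF.
Qed.

Lemma lebesgue_measure_shift (a : R) (A : set RR) : measurable A ->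
  mu [set x | A (x + a)%R] = mu A.
Proof.
move=> mA; rewrite -(lebesgue_measure_affine a ltr01 mA) mul1e.
by congr (mu _); apply/seteqP; split => x /=; rewrite mul1r.
Qed.

(** The hypothesis is openness. Such a set is the union of the countably many squares inside it with
    rational centres and half-sides 1/(n+1). *)
Lemma open_rectangles_measurable (S : set (RR * RR)) :
  (forall p, S p -> exists2 d : R, 0 < d & forall p' : RR * RR,
     `|p'.1 - p.1| < d -> `|p'.2 - p.2| < d -> S p') -> measurable S.
Proof.
move=> So.
pose B (i : rat * rat * nat) : set (RR * RR) :=
  [set x : RR | `|x - ratr i.1.1| < i.2.+1%:R^-1] `*`
  [set y : RR | `|y - ratr i.1.2| < i.2.+1%:R^-1].
have mB i : measurable (B i).
  have H (q : rat) : measurable [set x : RR | `|x - ratr q| < i.2.+1%:R^-1].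
    rewrite (_ : [set x : RR | _] = `](ratr q - i.2.+1%:R^-1), (ratr q + i.2.+1%:R^-1)[%classic).
      exact: measurable_itv.
    by apply/seteqP; split => x /=; rewrite in_itv/= ltr_distl.
  exact: measurableX.
rewrite (_ : S = \bigcup_i (if `[< B i `<=` S >] then B i else set0)).
  by apply: countable_bigcupT_measurable => // i; case: ifP.
apply/seteqP; split => [p Sp|p [i _]]; last first.
  by case: ifPn => // /asboolP; exact.
have [d d0 Hd] := So p Sp.
have [n Hn] : exists n : nat, n.+1%:R^-1 < d / 2.
  have d2 : 0 < (d / 2)^-1 by rewrite invr_gt0 divr_gt0.
  exists (Num.truncn (d / 2)^-1); rewrite invf_plt ?posrE ?divr_gt0//.
  exact: Num.Theory.truncnS_gt.
have n0 : 0 < n.+1%:R^-1 :> R by rewrite invr_gt0.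
have approx (x : R) : exists q : rat, `|x - ratr q| < n.+1%:R^-1.
  have : x - n.+1%:R^-1 < x + n.+1%:R^-1 by rewrite ltrD2l gtrN.
  move=> /rat_in_itvoo[q]; rewrite in_itv/= => H; exists q.
  by rewrite ltr_distlC.
have [q1 Hq1] := approx p.1; have [q2 Hq2] := approx p.2.
exists ((q1, q2), n) => //; rewrite asboolT// => p' [/= h1 h2].
apply: Hd.
- rewrite -(subrKA (ratr q1)) (le_lt_trans (ler_normD _ _))//.
  by rewrite [`|ratr q1 - _|]distrC [d]splitr ltrD// (lt_trans _ Hn).
- rewrite -(subrKA (ratr q2)) (le_lt_trans (ler_normD _ _))//.
  by rewrite [`|ratr q2 - _|]distrC [d]splitr ltrD// (lt_trans _ Hn).
Qed.

Lemma plane_measure_section_x (S : set (RR * RR)) : mu2 S = (\int[mu]_x mu (xsection S x))%E.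
Proof. by []. Qed.

Lemma plane_measure_section_y (S : set (RR * RR)) : measurable S ->
  plane_measure S = (\int[mu]_y mu (ysection S y))%E.
Proof. exact: product_measure_ysection. Qed.

Lemma measurable_shear_x (t : R) (S : set (RR * RR)) : measurable S ->
  measurable [set p : RR * RR | S (p.1 + t * p.2, p.2)].
Proof.
move=> mS; have mf : measurable_fun [set: RR * RR]
    ((fun p => (p.1 + t * p.2, p.2)) : RR * RR -> RR * RR).
  apply: measurable_fun_pair; last exact: measurable_snd.
  apply: measurable_funD; first exact: measurable_fst.
  by apply: measurable_funM => //; exact: measurable_snd.
by have := mf measurableT _ mS; rewrite setTI.
Qed.

Lemma measurable_shear_y (t : R) (S : set (RR * RR)) : measurable S ->
  measurable [set p : RR * RR | S (p.1, p.2 + t * p.1)].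
Proof.
move=> mS; have mf : measurable_fun [set: RR * RR]
    ((fun p => (p.1, p.2 + t * p.1)) : RR * RR -> RR * RR).
  apply: measurable_fun_pair; first exact: measurable_fst.
  apply: measurable_funD; first exact: measurable_snd.
  by apply: measurable_funM => //; exact: measurable_fst.
by have := mf measurableT _ mS; rewrite setTI.
Qed.

Lemma plane_measure_shear_x (t : R) (S : set (RR * RR)) : measurable S ->
  mu2 [set p | S (p.1 + t * p.2, p.2)%R] = mu2 S.
Proof.
move=> mS.
have mS' := measurable_shear_x t mS.
rewrite !plane_measure_section_y//; apply: eq_integral => y _.
rewrite -[RHS](lebesgue_measure_shift (t * y) (measurable_ysection y mS)).
congr (mu _); apply/seteqP; split => x; rewrite /ysection/= !inE//.
Qed.

Lemma plane_measure_shear_y (t : R) (S : set (RR * RR)) : measurable S ->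
  mu2 [set p | S (p.1, p.2 + t * p.1)%R] = mu2 S.
Proof.
move=> mS; rewrite !plane_measure_section_x; apply: eq_integral => x _.
rewrite -[RHS](lebesgue_measure_shift (t * x) (measurable_xsection x mS)).
congr (mu _); apply/seteqP; split => y; rewrite /xsection/= !inE//.
Qed.

Implicit Types (c s t : R).

Definition rotate (c s : R) (p : RR * RR) : RR * RR := (c * p.1 - s * p.2, s * p.1 + c * p.2).

Lemma measurable_rotate (c s : R) : measurable_fun setT (rotate c s).
Proof.
by apply: measurable_fun_pair; [apply: measurable_funB|apply: measurable_funD];
  apply: measurable_funM => //; (exact: measurable_fst || exact: measurable_snd).
Qed.

Lemma measurable_preim_rotate (c s : R) S : measurable S -> measurable (rotate c s @^-1` S).
Proof. by move=> mS; rewrite -[X in measurable X]setTI; exact: measurable_rotate. Qed.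

(* A rotation is a product of three shears, provided its angle is not pi. *)
Lemma plane_measure_rotate_shear (c s : R) S : c ^+ 2 + s ^+ 2 = 1 -> c != -1 -> measurable S ->
  mu2 (rotate c s @^-1` S) = mu2 S.
Proof.
(* Minus the tangent of half the angle; the middle shear has parameter [s]. *)
move=> cs c1 mS; pose t := - (s / (1 + c)).
have c0 : 1 + c != 0 by rewrite addrC -[1]opprK subr_eq0.
have ts : t * s = c - 1.
  rewrite /t mulNr mulrAC -expr2 (_ : s ^+ 2 = 1 - c ^+ 2); last first.
    by rewrite -cs addrAC subrr add0r.
  rewrite (_ : 1 - c ^+ 2 = (1 - c) * (1 + c)); last by ring.
  by rewrite mulfK//; ring.
have tc : t * (1 + c) = - s by rewrite /t mulNr divfK.
pose S1 : set (RR * RR) := [set p | S (p.1 + t * p.2, p.2)].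
pose S2 : set (RR * RR) := [set p | S1 (p.1, p.2 + s * p.1)].
have mS1 : measurable S1 by exact: measurable_shear_x.
have mS2 : measurable S2 by exact: measurable_shear_y.
apply: etrans (plane_measure_shear_x t mS); apply: etrans (plane_measure_shear_y s mS1).
apply: etrans (plane_measure_shear_x t mS2); congr (_ _); apply/seteqP.
have E x y : rotate c s (x, y) = (x + t * y + t * (y + s * (x + t * y)), y + s * (x + t * y)).
  have st : s * (t * y) = (c - 1) * y by rewrite -ts; ring.
  rewrite /rotate/=; congr (_, _); last by rewrite mulrDr st; ring.
  rewrite (_ : x + _ + _ = x + t * s * x + (t * y + t * y + t * (s * (t * y)))); last by ring.
  rewrite st ts (_ : _ + (_ + _) = c * x + t * (1 + c) * y); last by ring.
  by rewrite tc; ring.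
by split => -[x y]; rewrite /S2 /S1 /= E.
Qed.

(** The half-turn, which the three shears miss, is the square of the quarter-turn. *)
Lemma plane_measure_rotate (c s : R) S : c ^+ 2 + s ^+ 2 = 1 -> measurable S ->
  mu2 (rotate c s @^-1` S) = mu2 S.
Proof.
move=> cs mS; have [cN1|cN1] := eqVneq c (-1); last exact: plane_measure_rotate_shear.
have s0 : s = 0.
  apply/eqP; rewrite -(sqrf_eq0 s); move: cs.
  by rewrite cN1 sqrrN expr1n => /(canRL (addKr _)) ->; rewrite addrC subrr.
have i01 : 0 ^+ 2 + 1 ^+ 2 = 1 :> R by rewrite expr0n expr1n add0r.
have i0 : 0 != -1 :> R by rewrite eq_sym oppr_eq0 oner_eq0.
apply: etrans (plane_measure_rotate_shear i01 i0 mS).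
apply: etrans (plane_measure_rotate_shear i01 i0 (measurable_preim_rotate 0 1 mS)).
congr (_ _); apply/seteqP.
have E p : rotate c s p = rotate 0 1 (rotate 0 1 p).
  by rewrite /rotate/= cN1 s0; congr (_, _); ring.
by split => p; rewrite /preimage /= E.
Qed.

End PlaneMeasure.

(** * Averaging over rotations; areas of discs and annuli *)

Section RotationAverage.
Variable R : realType.
Local Notation mu := (@lebesgue_measure R).
Local Notation mu2 := (@plane_measure R).
Local Notation RR := (measurableTypeR R).

Lemma measurable_fun_cos : measurable_fun [set: RR] (@cos R : RR -> RR).
Proof. by apply: continuous_measurable_fun; exact: continuous_cos. Qed.

Lemma measurable_fun_sin : measurable_fun [set: RR] (@sin R : RR -> RR).
Proof. by apply: continuous_measurable_fun; exact: continuous_sin. Qed.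

Lemma measurable_rotate_angle : measurable_fun setT
  ((fun q => rotate (cos q.1) (sin q.1) q.2) : RR * (RR * RR) -> RR * RR).
Proof.
have m1 : measurable_fun setT ((fun q => q.2.1) : RR * (RR * RR) -> RR).
  exact: measurableT_comp measurable_fst measurable_snd.
have m2 : measurable_fun setT ((fun q => q.2.2) : RR * (RR * RR) -> RR).
  exact: measurableT_comp measurable_snd measurable_snd.
have mc : measurable_fun setT ((fun q => cos q.1) : RR * (RR * RR) -> RR).
  exact: measurableT_comp measurable_fun_cos measurable_fst.
have ms : measurable_fun setT ((fun q => sin q.1) : RR * (RR * RR) -> RR).
  exact: measurableT_comp measurable_fun_sin measurable_fst.
apply: measurable_fun_pair.
  exact: (measurable_funB (measurable_funM mc m1) (measurable_funM ms m2)).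
exact: (measurable_funD (measurable_funM ms m1) (measurable_funM mc m2)).
Qed.

Definition circle_section (S : set (RR * RR)) (p : RR * RR) : set RR :=
  [set t | 0 <= t <= 2 * pi /\ S (rotate (cos t) (sin t) p)].

(* Averaging over all rotations replaces polar coordinates. *)
Lemma rotation_average (S N : set (RR * RR)) (K : R) : 0 <= K ->
  measurable S -> measurable N ->
  (forall t p, S (rotate (cos t) (sin t) p) -> N p) ->
  (forall p, N p ->
    (mu (circle_section S p) <= K%:E)%E) ->
  ((2 * pi)%:E * mu2 S <= K%:E * mu2 N)%E.
Proof.
move=> K0 mS mN SN SK.
pose I : set RR := `[0, 2 * pi]%classic.
have mI : measurable I by exact: measurable_itv.
pose T : set (RR * (RR * RR)) :=
  (I `*` setT) `&`
  ((fun q => rotate (cos q.1) (sin q.1) q.2) : RR * (RR * RR) -> RR * RR) @^-1` S.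
have mT : measurable T.
  apply: measurableI; first by exact: measurableX.
  by rewrite -[X in measurable X]setTI; exact: measurable_rotate_angle.
(* The same set of pairs is sliced twice: a fixed angle leaves a rotated copy of [S], a fixed point
   [p] leaves [circle_section S p]. *)
have E1 : (mu \x mu2)%E T = ((2 * pi)%:E * mu2 S)%E.
  transitivity (\int[mu]_(t in I) (mu2 S))%E.
    rewrite [RHS]integral_mkcond/=; apply: eq_integral => t _.
    rewrite patchE; case: ifPn => [|] tI.
      rewrite -[RHS](plane_measure_rotate (cos2Dsin2 t) mS); congr (mu2 _).
      apply/seteqP; split => p; rewrite /xsection/= inE/=.
        by move=> [].
      by move=> Sp; split => //; split => //; move: tI; rewrite inE.
    rewrite /= -[RHS]/(0%E) (_ : xsection _ _ = set0) ?measure0//.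
    apply/seteqP; split => p //; rewrite /xsection/= inE/= => -[[/= h _] _].
    by move: tI; rewrite notin_setE.
  rewrite integral_cst// muleC; congr (_ * _)%E.
  by apply: etrans (lebesgue_measure_itv _) _; rewrite /= lte_fin mulr_gt0 ?pi_gt0// oppr0 adde0.
have E2 : (mu \x mu2)%E T = (\int[mu2]_p mu (ysection T p))%E.
  have := @product_measure_ysection _ _ _ _ _ mu mu2 T mT.
  by [].
rewrite -E1 E2.
apply: (@le_trans _ _ (\int[mu2]_(p in N) K%:E)%E); last by rewrite integral_cst.
rewrite [leRHS]integral_mkcond; apply: ge0_le_integral => //.
- by apply: measurable_fun_ysection.
- by apply/(measurable_restrict _ mN); rewrite ?setTI.
move=> p _; rewrite patchE; case: ifPn => [|] Np.
  apply: le_trans (SK p _); last by move: Np; rewrite inE.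
  rewrite le_eqVlt; apply/orP; left; apply/eqP; congr (mu _).
  apply/seteqP; split => t.
    by move=> /ysectionP[[/=]]; rewrite /I/= in_itv/=.
  by move=> [h h']; apply/ysectionP; split => //; split => //=; rewrite /I/= in_itv.
rewrite -[leRHS]/(0%E) (_ : ysection _ _ = set0) ?measure0//.
apply/seteqP; split => t // /ysectionP[_ /SN].
by move: Np; rewrite notin_setE.
Qed.

Lemma plane_measure_dilate_y (r : R) (S : set (RR * RR)) : 0 < r -> measurable S ->
  (r%:E * mu2 [set p | S (p.1, r * p.2)%R] = mu2 S)%E.
Proof.
move=> r0 mS.
have mS' : measurable [set p : RR * RR | S (p.1, r * p.2)%R].
  have mf : measurable_fun [set: RR * RR] ((fun p => (p.1, r * p.2)) : RR * RR -> RR * RR).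
    apply: measurable_fun_pair; first exact: measurable_fst.
    by apply: measurable_funM => //; exact: measurable_snd.
  by have := mf measurableT _ mS; rewrite setTI.
rewrite !plane_measure_section_x -ge0_integralZl//; last 2 first.
- exact: measurable_fun_xsection.
- by rewrite lee_fin ltW.
apply: eq_integral => x _.
rewrite -[RHS](lebesgue_measure_affine 0 r0 (measurable_xsection x mS)).
congr (_ * mu _)%E; apply/seteqP; split => y; rewrite /xsection/= !inE/= addr0//.
Qed.

Lemma plane_measure_dilate_x (r : R) (S : set (RR * RR)) : 0 < r -> measurable S ->
  (r%:E * mu2 [set p | S (r * p.1, p.2)%R] = mu2 S)%E.
Proof.
move=> r0 mS.
have mS' : measurable [set p : RR * RR | S (r * p.1, p.2)%R].
  have mf : measurable_fun [set: RR * RR] ((fun p => (r * p.1, p.2)) : RR * RR -> RR * RR).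
    apply: measurable_fun_pair; last exact: measurable_snd.
    by apply: measurable_funM => //; exact: measurable_fst.
  by have := mf measurableT _ mS; rewrite setTI.
rewrite !plane_measure_section_y// -ge0_integralZl//; last 2 first.
- exact: measurable_fun_ysection.
- by rewrite lee_fin ltW.
apply: eq_integral => y _.
rewrite -[RHS](lebesgue_measure_affine 0 r0 (measurable_ysection y mS)).
congr (_ * mu _)%E; apply/seteqP; split => x; rewrite /ysection/= !inE/= addr0//.
Qed.

Definition disc (r : R) : set (RR * RR) := [set p | p.1 ^+ 2 + p.2 ^+ 2 < r ^+ 2].

Lemma measurable_sqr_norm : measurable_fun setT ((fun p => p.1 ^+ 2 + p.2 ^+ 2) : RR * RR -> RR).
Proof.
by apply: measurable_funD; apply: measurable_funX; [exact: measurable_fst|exact: measurable_snd].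
Qed.

Lemma measurable_disc (r : R) : measurable (disc r).
Proof.
have := measurable_sqr_norm measurableT (measurable_itv `]-oo, (r ^+ 2)[).
rewrite setTI (_ : _ @^-1` _ = disc r)//.
Qed.

Lemma plane_measure_disc (r : R) : 0 < r -> mu2 (disc r) = ((r ^+ 2)%:E * mu2 (disc 1))%E.
Proof.
move=> r0; rewrite -(plane_measure_dilate_x r0 (measurable_disc r)).
have mS : measurable [set p : RR * RR | disc r (r * p.1, p.2)%R].
  have mf : measurable_fun [set: RR * RR] ((fun p => (r * p.1, p.2)) : RR * RR -> RR * RR).
    apply: measurable_fun_pair; last exact: measurable_snd.
    by apply: measurable_funM => //; exact: measurable_fst.
  by have := mf measurableT _ (measurable_disc r); rewrite setTI.
rewrite -(plane_measure_dilate_y r0 mS) muleA -EFinM -expr2; congr (_ * mu2 _)%E.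
have E p : ((r * p.1) ^+ 2 + (r * p.2) ^+ 2 < r ^+ 2) = (p.1 ^+ 2 + p.2 ^+ 2 < 1 ^+ 2).
  by rewrite !exprMn -mulrDr expr1n -[X in _ < X]mulr1 ltr_pM2l// exprn_gt0.
by apply/seteqP; split => p; rewrite /disc/= E.
Qed.

Lemma plane_measure_unit_disc_le : (mu2 (disc 1) <= 4%:E)%E.
Proof.
pose I := `[(-1 : R), 1]%classic : set RR.
have mI : measurable I by exact: measurable_itv.
apply: (@le_trans _ _ (mu2 (I `*` I))).
  apply: le_measure; rewrite ?inE; [exact: measurable_disc|exact: measurableX|].
  move=> p; rewrite /disc /= expr1n => h; split;
    rewrite /I/= in_itv/= -ler_norml -(@ler_pXn2r _ 2) ?nnegrE// expr1n;
    rewrite real_normK ?num_real//.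
    by have := sqr_ge0 p.2; lra.
  by have := sqr_ge0 p.1; lra.
rewrite plane_measure_prod// !lebesgue_measure_itv/= lte_fin.
by rewrite ifT; [rewrite -EFinD -EFinM lee_fin; lra|lra].
Qed.

(** By scaling, the area is [r2 ^+ 2 - r1 ^+ 2] times that of the unit disc; the 4 is the area of
    the circumscribed square. *)
Lemma plane_measure_annulus_le (r1 r2 : R) : 0 < r1 -> r1 <= r2 ->
  (mu2 [set p | r1 ^+ 2 <= p.1 ^+ 2 + p.2 ^+ 2 < r2 ^+ 2]%R <= (4 * (r2 ^+ 2 - r1 ^+ 2))%:E)%E.
Proof.
move=> r10 r12; have r20 : 0 < r2 by exact: lt_le_trans r12.
have d1fin : mu2 (disc 1) \is a fin_num.
  by rewrite ge0_fin_numE// (le_lt_trans plane_measure_unit_disc_le)// ltry.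
rewrite (_ : [set p | _] = disc r2 `\` disc r1); last first.
  apply/seteqP; split => p; rewrite /disc/=.
    by move=> /andP[h1 h2]; split => //; rewrite ltNge h1.
  by move=> [h1 /negP]; rewrite -leNgt => ->.
have sub : disc r1 `<=` disc r2.
  move=> p; rewrite /disc/= => /lt_le_trans; apply.
  by rewrite ler_pXn2r// nnegrE ltW.
have fin2 : (mu2 (disc r2) < +oo)%E.
  by rewrite plane_measure_disc// -ge0_fin_numE ?mule_ge0// ?lee_fin ?sqr_ge0// fin_numM.
have -> : mu2 (disc r2 `\` disc r1) = (mu2 (disc r2) - mu2 (disc r1))%E.
  apply: etrans (measureD (measurable_disc r2) (measurable_disc r1) fin2) _.
  by congr (_ - mu2 _)%E; apply/setIidPr.
rewrite (plane_measure_disc r20) (plane_measure_disc r10).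
have := plane_measure_unit_disc_le; rewrite -(fineK d1fin); set v := fine _ => v4.
rewrite lee_fin in v4; rewrite -!EFinM -EFinB lee_fin -mulrBl mulrC ler_wpM2r//.
by rewrite subr_ge0 ler_pXn2r// nnegrE ltW.
Qed.
End RotationAverage.

(** * Harnack inequalities and small sublevel sets *)

Section Harnack.
Variable R : realType.
Local Notation C := R[i].
Local Notation nc := (@normc R).
Local Notation mu := (@lebesgue_measure R).
Implicit Types (z w : C).
Variable g : C -> C.
Hypothesis dg : forall z, nc z < 1 -> cdiff g z.
Hypothesis g0 : forall z, nc z < 1 -> 0 <= complex.Re (g z).

Lemma normc_circle c y : nc (c * cexp 0 y) = nc c.
Proof. by rewrite normc_polar expR0 mulr1. Qed.

Lemma poisson_kernel_ge0 (r : R) w z : nc w <= r -> 0 <= poisson_kernel r w z.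
Proof.
move=> wr; rewrite divr_ge0 ?sqr_ge0// subr_ge0 ler_pXn2r// ?nnegrE ?normc_ge0//.
exact: le_trans (normc_ge0 _) wr.
Qed.

Lemma normc_dist_ge z w : nc z - nc w <= nc (z - w).
Proof. by rewrite lerBlDr -{1}(subrK w z) le_normcD. Qed.

(** With depths d = 1 - |z| and d' = 1 - |w|, the circle runs halfway between [z] and the unit
    circle. The numerators are at most d and at least d'/4, and |zeta - w| <= 5 (d'/d) |zeta - z|
    because |zeta - z| >= d/2. Hence 100 = 4 * 5^2. *)
Lemma poisson_kernel_harnack (z w zeta : C) : nc z < 1 -> nc w < 1 ->
  1 - nc z <= 1 - nc w -> nc (z - w) <= 2 * (1 - nc w) ->
  nc zeta = (1 + nc z) / 2 ->
  poisson_kernel ((1 + nc z) / 2) z zeta <=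
    100 * ((1 - nc w) / (1 - nc z)) * poisson_kernel ((1 + nc z) / 2) w zeta.
Proof.
move=> z1 w1 dd' zw zetar.
set r := (1 + nc z) / 2 in zetar *; set d := 1 - nc z in dd' *; set d' := 1 - nc w in dd' zw *.
have nz0 := normc_ge0 z; have nw0 := normc_ge0 w.
have d0 : 0 < d by rewrite subr_gt0.
have d'0 : 0 < d' by rewrite subr_gt0.
have A : d / 2 <= nc (zeta - z).
  apply: le_trans (normc_dist_ge _ _); rewrite zetar /r /d; lra.
have A0 : 0 < nc (zeta - z) by apply: lt_le_trans A; rewrite divr_gt0.
have B0 : 0 < nc (zeta - w).
  apply: lt_le_trans (normc_dist_ge _ _); rewrite zetar /r.
  by rewrite /d /d' in dd' d'0 *; lra.
have B : nc (zeta - w) <= 5 * (d' / d) * nc (zeta - z).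
  have -> : zeta - w = (zeta - z) + (z - w) by ring.
  apply: (le_trans (le_normcD _ _)); apply: (le_trans (lerD (lexx _) zw)).
  have h1 : nc (zeta - z) <= d' / d * nc (zeta - z).
    by rewrite ler_peMl ?normc_ge0// ler_pdivlMr// mul1r.
  have h2 : d' <= 2 * (d' / d * nc (zeta - z)).
    have -> : 2 * (d' / d * nc (zeta - z)) = d' * (2 * nc (zeta - z) / d) by ring.
    by rewrite ler_peMr ?(ltW d'0)// ler_pdivlMr// mul1r; lra.
  by rewrite -mulrA; lra.
have N1 : r ^+ 2 - nc z ^+ 2 <= d.
  have -> : r ^+ 2 - nc z ^+ 2 = (r - nc z) * (r + nc z) by ring.
  have -> : r - nc z = d / 2 by rewrite /r /d; field.
  have : r + nc z <= 2 by rewrite /r; lra.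
  by move=> /(ler_wpM2l (ltW (divr_gt0 d0 (ltr0n R 2)))); lra.
have N2 : d' / 4 <= r ^+ 2 - nc w ^+ 2.
  have -> : r ^+ 2 - nc w ^+ 2 = (r - nc w) * (r + nc w) by ring.
  have h1 : d' / 2 <= r - nc w by move: dd'; rewrite /r /d /d'; lra.
  have h2 : 1 / 2 <= r + nc w by rewrite /r; lra.
  have : d' / 2 * (1 / 2) <= (r - nc w) * (r + nc w).
    by apply: ler_pM => //; rewrite ?divr_ge0// ltW.
  by lra.
rewrite /poisson_kernel ler_pdivrMr ?exprn_gt0//.
apply: (le_trans N1).
have -> : 100 * (d' / d) * ((r ^+ 2 - nc w ^+ 2) / nc (zeta - w) ^+ 2) * nc (zeta - z) ^+ 2
  = (100 * (d' / d) * (r ^+ 2 - nc w ^+ 2) * nc (zeta - z) ^+ 2) / nc (zeta - w) ^+ 2 by ring.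
rewrite ler_pdivlMr ?exprn_gt0//.
have B2 : nc (zeta - w) ^+ 2 <= (5 * (d' / d) * nc (zeta - z)) ^+ 2.
  by rewrite ler_pXn2r// nnegrE ?(ltW B0)// !mulr_ge0// ?invr_ge0 ltW.
apply: (le_trans (ler_wpM2l (ltW d0) B2)).
have dn : d != 0 by rewrite gt_eqF.
have -> : d * (5 * (d' / d) * nc (zeta - z)) ^+ 2 =
   100 * (d' / d) * (d' / 4) * nc (zeta - z) ^+ 2 by field.
rewrite ler_wpM2r ?sqr_ge0// ler_wpM2l// mulr_ge0// divr_ge0// ltW//.
Qed.

(** The comparison of kernels, integrated against the nonnegative [Re g]. The loss is linear in the
    ratio of the depths, which is what allows [N] to be as large as a multiple of [1 / eps]. *)
Lemma harnack z w : nc z < 1 -> nc w < 1 ->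
  1 - nc z <= 1 - nc w -> nc (z - w) <= 2 * (1 - nc w) ->
  complex.Re (g z) <= 100 * ((1 - nc w) / (1 - nc z)) * complex.Re (g w).
Proof.
move=> z1 w1 dd' zw; have nz0 := normc_ge0 z.
set r := (1 + nc z) / 2.
have r1 : r < 1 by rewrite /r; lra.
have zr : nc z < r by rewrite /r; lra.
have wr : nc w < r by apply: le_lt_trans zr; lra.
pose c : C := r%:C%C.
have cr : nc c = r.
  by rewrite normc_sqrtE /= expr0n addr0 sqrtr_sqr ger0_norm// (le_trans nz0)// ltW.
have c1 : nc c < 1 by rewrite cr.
have zc : nc z < nc c by rewrite cr.
have wc : nc w < nc c by rewrite cr.
have [I1 E1] := poisson_formula c1 zc dg; have [I2 E2] := poisson_formula c1 wc dg.
rewrite cr in I1 E1 I2 E2.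
set K := 100 * _.
have p0 : 0 < 2 * pi :> R by rewrite mulr_gt0 ?pi_gt0.
rewrite -(ler_pM2l p0) mulrCA -E1 -E2.
rewrite -RintegralZl//.
apply: le_Rintegral => // [|y _].
  by have := @integrableZl _ _ _ mu _ (measurable_itv `[0, 2 * pi]) K _ I2.
rewrite mulrA ler_wpM2r//; last first.
  by apply: poisson_kernel_harnack => //; rewrite normc_circle cr.
by apply: g0; rewrite normc_circle cr.
Qed.

(** Chebyshev's inequality for the density kernel times [Re g] on the circle, whose total mass is
    [2 * pi * Re (g w)] by the Poisson formula. *)
Lemma circle_measure_le (T : set (measurableTypeR R)) c w (K : R) :
  0 <= K -> nc c < 1 -> nc w < nc c -> measurable T ->
  (forall t, T t -> 0 <= t <= 2 * pi) ->
  (forall t, T t -> 1 <= K *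
    (poisson_kernel (nc c) w (c * cexp 0 t) * complex.Re (g (c * cexp 0 t)))) ->
  (mu T <= (K * (2 * pi * complex.Re (g w)))%:E)%E.
Proof.
move=> K0 c1 wc mT T0 SK.
have [I1 E1] := poisson_formula c1 wc dg.
pose f y := poisson_kernel (nc c) w (c * cexp 0 y) * complex.Re (g (c * cexp 0 y)).
have mI : measurable (`[0, 2 * pi]%classic : set (measurableTypeR R)) by exact: measurable_itv.
have f0 y : 0 <= f y.
  apply: mulr_ge0; first by apply: poisson_kernel_ge0; exact: ltW.
  by apply: g0; rewrite normc_circle.
have mf : measurable_fun (`[0, 2 * pi]%classic : set (measurableTypeR R)) f.
  by apply/measurable_EFinP; case/integrableP : I1.
have TI : T `<=` `[0, 2 * pi]%classic by move=> t /T0 h; rewrite /= in_itv.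
rewrite -[mu T]mul1e -(integral_cst mu mT 1).
apply: (@le_trans _ _ (\int[mu]_(y in T) (K * f y)%:E)%E).
  apply: ge0_le_integral => //.
  apply/measurable_EFinP; apply: measurable_funM => //.
  exact: measurable_funS mf.
apply: (@le_trans _ _ (\int[mu]_(y in `[0%R, (2 * pi)%R]) (K * f y)%:E)%E).
  apply: ge0_subset_integral => //.
    by apply/measurable_EFinP; apply: measurable_funM.
  by move=> y _; rewrite lee_fin mulr_ge0.
under eq_integral do rewrite EFinM.
rewrite integralZl//.
have -> : (\int[mu]_(y in `[0%R, (2 * pi)%R]) (f y)%:E)%E = (2 * pi * complex.Re (g w))%:E.
  rewrite -E1 /Rintegral fineK//; exact: integrable_fin_num.
by rewrite -EFinM.
Qed.

End Harnack.

(** * Sublevel sets and the function t / (t + q) *)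

Section Sublevel.
Variable R : realType.
Local Notation C := R[i].
Local Notation nc := (@normc R).
Local Notation RR := (measurableTypeR R).
Implicit Types (z w : C) (p : RR * RR).

Definition cplx (p : RR * RR) : C := Complex p.1 p.2.

Lemma sqr_normc_cplx p : nc (cplx p) ^+ 2 = p.1 ^+ 2 + p.2 ^+ 2.
Proof. by rewrite sqr_normc. Qed.

Lemma cplx_rotate t p : cplx (rotate (cos t) (sin t) p) = cplx p * cexp 0 t.
Proof.
apply/eqP; rewrite eq_complex /= expR0 !mul1r.
by apply/andP; split; apply/eqP; ring.
Qed.

Lemma measurable_normc_cplx : measurable_fun setT (fun p => nc (cplx p)).
Proof.
rewrite (_ : (fun p => _) = fun p => Num.sqrt (p.1 ^+ 2 + p.2 ^+ 2)); last first.
  by apply/funext => p; rewrite normc_sqrtE.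
apply: (@measurableT_comp _ _ _ _ _ _ (@Num.sqrt R : RR -> RR)).
  by apply: continuous_measurable_fun; exact: sqrt_continuous.
exact: measurable_sqr_norm.
Qed.

Definition sublevel (q : C -> C) (t : R) : set (RR * RR) :=
  [set p | nc (cplx p) < 1 /\ nc (q (cplx p)) < t].

Lemma normc_cplx_le (p p' : RR * RR) : nc (cplx p' - cplx p) <= `|p'.1 - p.1| + `|p'.2 - p.2|.
Proof. exact: normc_le_ReIm. Qed.

Lemma measurable_sublevel q t : (forall z, nc z < 1 -> ccont q z) ->
  measurable (sublevel q t).
Proof.
move=> cq; apply: open_rectangles_measurable => p [p1 pt].
have e0 : 0 < t - nc (q (cplx p)) by rewrite subr_gt0.
have [d d0 Hd] := cq _ p1 _ e0.
have p0 : 0 < 1 - nc (cplx p) by rewrite subr_gt0.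
pose D := Num.min d (1 - nc (cplx p)).
have D0 : 0 < D by rewrite lt_min d0.
exists (D / 2); first by rewrite divr_gt0.
move=> p' h1 h2; have H : nc (cplx p' - cplx p) < D.
  by apply: le_lt_trans (normc_cplx_le _ _) _; rewrite [D]splitr ltrD.
move: H; rewrite lt_min => /andP[/Hd H1 H2].
rewrite (addrC (cplx p)) subrK in H1; split.
- rewrite -(subrK (cplx p) (cplx p')); apply: le_lt_trans (le_normcD _ _) _.
  by rewrite -ltrBrDr.
- rewrite -(subrK (q (cplx p)) (q (cplx p'))); apply: le_lt_trans (le_normcD _ _) _.
  by rewrite -ltrBrDr.
Qed.

Variable q : C -> C.
Hypothesis dq : forall z, nc z < 1 -> cdiff q z.
Hypothesis q0 : forall z, nc z < 1 -> 0 < complex.Re (q z).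

(** The Möbius map s -> t / (t + s) sends the right half-plane to the disc with diameter [0, 1] and
    the half-circle |s| = t to the line Re = 1/2; this is where the bounds on its real part come
    from. *)
Definition bump (t : R) z := t%:C%C * (t%:C%C + q z)^-1.

Lemma bump_den_neq0 (t : R) z : 0 < t -> nc z < 1 -> t%:C%C + q z != 0.
Proof.
move=> t0 z1; apply/eqP => H; have := congr1 (@complex.Re R) H.
by rewrite ReD /= => /eqP; rewrite gt_eqF// addr_gt0// q0.
Qed.

Lemma cdiff_bump (t : R) z : 0 < t -> nc z < 1 -> cdiff (bump t) z.
Proof.
move=> t0 z1; apply: (@cdiffM _ (fun=> t%:C%C) (fun z => (t%:C%C + q z)^-1)).
  exact: cdiff_cst.
apply: (@cdiffV _ (fun z => t%:C%C + q z)); first exact: bump_den_neq0.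
apply: (@cdiffD _ (fun=> t%:C%C) q); [exact: cdiff_cst|exact: dq].
Qed.

Lemma Re_bumpE (t : R) z : complex.Re (bump t z) =
  t * (t + complex.Re (q z)) / ((t + complex.Re (q z)) ^+ 2 + complex.Im (q z) ^+ 2).
Proof.
rewrite /bump Re_realM; case: (q z) => a b /=; rewrite add0r mulrA//.
Qed.

Section BumpBounds.
Variables (t : R) (z : C).
Hypotheses (t0 : 0 < t) (z1 : nc z < 1).
Let a := complex.Re (q z).
Let b := complex.Im (q z).
Let a0 : 0 < a. Proof. exact: q0. Qed.
Let den0 : 0 < (t + a) ^+ 2 + b ^+ 2.
Proof. by rewrite ltr_pwDl ?sqr_ge0// exprn_gt0// addr_gt0. Qed.

Lemma normc_q_gt0 : 0 < nc (q z).
Proof. by apply: lt_le_trans (Re_le_normc _); rewrite gtr0_norm. Qed.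

Lemma Re_bump_ge0 : 0 <= complex.Re (bump t z).
Proof.
rewrite Re_bumpE divr_ge0 ?(ltW den0)// mulr_ge0 ?(ltW t0)//.
by rewrite ltW// addr_gt0.
Qed.

Lemma Re_bump_ge_half : nc (q z) < t -> 1 / 2 <= complex.Re (bump t z).
Proof.
move=> qt; have : nc (q z) ^+ 2 <= t ^+ 2 by rewrite ler_pXn2r ?nnegrE ?normc_ge0 ?ltW.
rewrite sqr_normc -/a -/b Re_bumpE -/a -/b => H.
by rewrite ler_pdivlMr//; lra.
Qed.

Lemma Re_bump_le1 : complex.Re (bump t z) <= 1.
Proof.
rewrite Re_bumpE -/a -/b ler_pdivrMr// mul1r.
have := sqr_ge0 b; have := mulr_ge0 (ltW t0) (ltW a0); have := sqr_ge0 a; lra.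
Qed.

Lemma Re_bump_le : complex.Re (bump t z) <= t / nc (q z).
Proof.
have E1 : complex.Re (t%:C%C + q z) = t + a by rewrite ReD.
have E2 : complex.Im (t%:C%C + q z) = b.
  by rewrite /b; case: (q z) => ? ? /=; rewrite add0r.
have B : nc (bump t z) <= t / nc (q z).
  rewrite /bump normcM normcV.
  have -> : nc t%:C%C = t by rewrite normc_sqrtE /= expr0n addr0 sqrtr_sqr gtr0_norm.
  rewrite ler_wpM2l ?(ltW t0)// lef_pV2 ?posrE ?normc_q_gt0//.
    rewrite -(@ler_pXn2r _ 2) ?nnegrE ?normc_ge0// !sqr_normc.
    rewrite E1 E2 -/a -/b.
    have := mulr_ge0 (ltW t0) (ltW a0); have := sqr_ge0 t; lra.
  by rewrite normc_gt0 bump_den_neq0.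
apply: le_trans B; apply: le_trans (Re_le_normc _); exact: ler_norm.
Qed.
End BumpBounds.

(* Harnack's inequality for the positive harmonic function [Re (t / (t + q))],
   which is at least 1/2 where [|q| < t] and at most [t / |q|] everywhere. *)
Lemma sublevel_propagate (t : R) z w : 0 < t -> nc z < 1 -> nc w < 1 ->
  nc (q z) < t -> 1 - nc z <= 1 - nc w -> nc (z - w) <= 2 * (1 - nc w) ->
  nc (q w) <= 200 * t * ((1 - nc w) / (1 - nc z)).
Proof.
move=> t0 z1 w1 qt dd' zw.
have H := @harnack R (bump t) (fun z hz => cdiff_bump t0 hz) (fun z hz => Re_bump_ge0 t0 hz)
  z w z1 w1 dd' zw.
have h1 := Re_bump_ge_half t0 z1 qt; have h2 := Re_bump_le t0 w1.
have qw := normc_q_gt0 w1.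
set D := (1 - nc w) / (1 - nc z) in H *.
have D0 : 0 <= 100 * D by rewrite mulr_ge0// divr_ge0// subr_ge0 ltW.
have := le_trans h1 (le_trans H (ler_wpM2l D0 h2)).
by rewrite mulrA ler_pdivlMr//; lra.
Qed.
End Sublevel.

(** * Counting pairs of points in two ways *)

Section MainEstimate.
Variable R : realType.
Local Notation C := R[i].
Local Notation nc := (@normc R).
Local Notation mu := (@lebesgue_measure R).
Local Notation mu2 := (@plane_measure R).
Local Notation RR := (measurableTypeR R).
Variable q : C -> C.
Hypothesis dq : forall z, nc z < 1 -> cdiff q z.
Hypothesis q0 : forall z, nc z < 1 -> 0 < complex.Re (q z).
Variables h eps N : R.
Hypothesis h0 : 0 < h.
Hypothesis hq : h < nc (q 0).
Hypothesis eps0 : 0 < eps.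
Hypothesis N_ge2 : 2 <= N.
Hypothesis epsN : 8 * (100 * (eps * N)) <= 1.
Let t := eps * h.
Let d p := 1 - nc (cplx p) : R.

Let N0 : 0 < N. Proof. exact: lt_le_trans N_ge2. Qed.
Let t0 : 0 < t. Proof. exact: mulr_gt0. Qed.

(* The points about [N] times farther from the circle than [p], and near [p] on
   that scale. The pairs [(p, p')] with [p'] in the shadow of [p], where [p] is in
   the small sublevel set, are counted in two ways: each [p] has a large shadow,
   and each [p'] is in the shadow of few such [p], by the Poisson formula on the
   circles through them. *)
Definition shadow (p p' : RR * RR) : Prop :=
  [/\ nc (cplx p') < 1, N * d p <= d p', d p' < 2 * N * d p &
      nc (cplx p - cplx p') <= 2 * d p'].

Let d_gt0 p : nc (cplx p) < 1 -> 0 < d p.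
Proof. by rewrite subr_gt0. Qed.

(** Harnack's inequality from [p] to the origin gives [h < |q 0| <= 200 * eps * h / d p], hence
    [d p < 200 * eps], and [epsN] turns this into the bound. It leaves room inside the disc for the
    points of the shadow. *)
Lemma sublevel_depth p : sublevel q t p -> N * d p < 4^-1.
Proof.
move=> [p1 qp].
have n0 : nc (0 : C) = 0 := normc0 R.
have := @sublevel_propagate R q dq q0 t (cplx p) 0 t0 p1.
rewrite n0 subr0 subr0 mulr1 => /(_ ltr01 qp).
have le1 : 1 - nc (cplx p) <= 1 by rewrite lerBlDr lerDl normc_ge0.
move=> /(_ le1); have le2 : nc (cplx p) <= 2 by apply/ltW/(lt_trans p1); lra.
move=> /(_ le2) /(lt_le_trans hq).
rewrite -/(d p) mulrA mulr1 ltr_pdivlMr ?d_gt0// /t.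
rewrite (_ : 200 * (eps * h) = (200 * eps) * h); last by ring.
rewrite mulrC ltr_pM2r// => H.
have := ltr_pM2l N0 (d p) (200 * eps); rewrite H => H'.
apply: lt_le_trans H' _.
by rewrite (_ : N * (200 * eps) = 2 * (100 * (eps * N))); [move: epsN; lra|ring].
Qed.

(** The ratio of depths is below [2 * N], so Harnack's inequality gives
    [|q p'| <= 400 * eps * N * h], and [epsN] makes this at most [h / 2]. *)
Lemma shadow_sublevel p p' : sublevel q t p -> shadow p p' -> sublevel q h p'.
Proof.
move=> Ep [p1 Nd d2N pp]; have [pl1 qp] := Ep; split => //.
have d0 := d_gt0 pl1.
have dd : 1 - nc (cplx p) <= 1 - nc (cplx p').
  apply: le_trans Nd; rewrite -/(d p) ler_peMl ?(ltW d0)//.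
  by apply: le_trans N_ge2; lra.
apply: le_lt_trans (sublevel_propagate dq q0 t0 pl1 p1 qp dd pp) _.
rewrite -/(d p) -/(d p').
have : d p' / d p <= 2 * N by rewrite ler_pdivrMr// ltW.
have t2 : 0 <= 200 * t by rewrite mulr_ge0// ltW.
move=> /(ler_wpM2l t2) /le_lt_trans; apply.
rewrite /t (_ : 200 * (eps * h) * (2 * N) = h * (4 * (100 * (eps * N)))); last by ring.
by rewrite gtr_pMr//; move: epsN; lra.
Qed.

(* The square of side s/4, s = N d, around the point of depth 3s/2 on the
   radius of p. *)
Lemma shadow_large p : sublevel q t p -> exists2 S : set (RR * RR),
  measurable S /\ S `<=` shadow p & mu2 S = (((N * d p) ^+ 2) / 16)%:E.
Proof.
move=> Ep; have [p1 qp] := Ep; have s4 := sublevel_depth Ep.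
have d0 := d_gt0 p1; set s := N * d p in s4 *.
have s0 : 0 < s by exact: mulr_gt0.
have ds : d p <= s by rewrite ler_peMl ?(ltW d0)//; apply: le_trans N_ge2; lra.
have nE : nc (cplx p) = 1 - d p by rewrite /d; ring.
have np0 : 0 < nc (cplx p) by rewrite nE; lra.
pose k := (1 - 3 / 2 * s) / nc (cplx p).
have kn : k * nc (cplx p) = 1 - 3 / 2 * s by rewrite divfK// gt_eqF.
have k0 : 0 <= k by rewrite divr_ge0 ?(ltW np0)//; lra.
pose c : RR * RR := (k * p.1, k * p.2).
have cE : cplx c = k%:C%C * cplx p.
  by apply/eqP; rewrite eq_complex /= !mul0r subr0 addr0 !eqxx.
have nk (a : R) : nc (a%:C%C) = `|a| by rewrite normc_sqrtE /= expr0n addr0 sqrtr_sqr.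
have cn : nc (cplx c) = 1 - 3 / 2 * s by rewrite cE normcM nk ger0_norm.
have cp : nc (cplx p - cplx c) <= 3 / 2 * s.
  rewrite cE -[cplx p in X in X - _]mul1r -mulrBl normcM.
  rewrite (_ : 1 - k%:C%C = (1 - k)%:C%C); last by rewrite rmorphB rmorph1.
  rewrite nk -[X in _ * X](ger0_norm (ltW np0)) -normrM mulrBl mul1r kn nE.
  by rewrite ler_norml; apply/andP; split; lra.
(* Points of the square are within s/4 of [c]. Their depths lie between 5s/4 and 7s/4 and their
   distances to [p] are at most 7s/4, so every condition of [shadow] holds with room to spare. *)
pose I (a : R) : set RR := `[a - s / 8, a + s / 8]%classic.
have mI a : measurable (I a) by exact: measurable_itv.
exists (I c.1 `*` I c.2).
  split; first exact: measurableX.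
  move=> p' [/=]; rewrite /I/= !in_itv/= -!ler_distl => h1 h2.
  have pc : nc (cplx p' - cplx c) <= s / 4.
    by apply: le_trans (normc_cplx_le _ _) _; apply: le_trans (lerD h1 h2) _; lra.
  have a1 : nc (cplx p') <= 1 - 3 / 2 * s + s / 4.
    rewrite -(subrK (cplx c) (cplx p')); apply: le_trans (le_normcD _ _) _.
    by rewrite cn; lra.
  have a2 : 1 - 3 / 2 * s - s / 4 <= nc (cplx p').
    have := normc_dist_ge (cplx c) (cplx p'); rewrite normc_distC cn; lra.
  have a3 : nc (cplx p - cplx p') <= 3 / 2 * s + s / 4.
    rewrite -(subrKA (cplx c)); apply: le_trans (le_normcD _ _) _.
    by rewrite [X in _ + X]normc_distC; exact: lerD.
  split.
  - lra.
  - by rewrite -/s /d; lra.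
  - by rewrite -mulrA -/s /d; lra.
  - by rewrite /d; lra.
have mI' a : mu (I a) = (s / 4)%:E.
  rewrite /I; apply: etrans (lebesgue_measure_itv _) _; rewrite /= lte_fin.
  rewrite ifT; last by lra.
  by rewrite -EFinB; congr (_%:E); lra.
rewrite plane_measure_prod// !mI' -EFinM; congr (_%:E).
by rewrite expr2; lra.
Qed.

(** With d' = 1 - |w|, the numerator is at least d'/4 and the denominator at most (2d')^2. *)
Lemma poisson_kernel_lower (w z : C) (r : R) : nc z = r -> nc w < 1 ->
  0 < 1 - r -> 1 - r <= (1 - nc w) / 2 -> nc (z - w) <= 2 * (1 - nc w) ->
  (16 * (1 - nc w))^-1 <= poisson_kernel r w z.
Proof.
move=> zr w1 r1 rw zw; have nw := normc_ge0 w.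
set d' := 1 - nc w in rw zw *.
have d'0 : 0 < d' by rewrite subr_gt0.
have zw0 : 0 < nc (z - w).
  by apply: lt_le_trans (normc_dist_ge _ _); rewrite zr; rewrite /d' in rw d'0; lra.
rewrite /poisson_kernel ler_pdivlMr ?exprn_gt0//.
have : nc (z - w) ^+ 2 <= (2 * d') ^+ 2.
  by rewrite ler_pXn2r// nnegrE ?(ltW zw0)// mulr_ge0// ltW.
have i0 : 0 <= (16 * d')^-1 by rewrite invr_ge0 mulr_ge0// ltW.
move=> /(ler_wpM2l i0) /le_trans; apply.
have -> : (16 * d')^-1 * (2 * d') ^+ 2 = d' / 4 by field; rewrite gt_eqF.
have -> : r ^+ 2 - nc w ^+ 2 = (r - nc w) * (r + nc w) by ring.
have h1 : d' / 2 <= r - nc w by rewrite /d' in rw *; lra.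
have h2 : 1 / 2 <= r + nc w by rewrite /d' in rw *; lra.
have : d' / 2 * (1 / 2) <= (r - nc w) * (r + nc w).
  by apply: ler_pM => //; rewrite divr_ge0// ltW.
by lra.
Qed.

Lemma measurable_le_set dd (T : measurableType dd) (f g : T -> R) :
  measurable_fun setT f -> measurable_fun setT g -> measurable [set x | f x <= g x].
Proof.
move=> mf mg; have := measurable_funB mg mf measurableT (measurable_itv `[0, +oo[).
rewrite setTI (_ : _ @^-1` _ = [set x | f x <= g x])//.
by apply/seteqP; split => x /=; rewrite in_itv/= andbT subr_ge0.
Qed.

Lemma measurable_lt_set dd (T : measurableType dd) (f g : T -> R) :
  measurable_fun setT f -> measurable_fun setT g -> measurable [set x | f x < g x].
Proof.
move=> mf mg; have := measurable_funB mg mf measurableT (measurable_itv `]0, +oo[).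
rewrite setTI (_ : _ @^-1` _ = [set x | f x < g x])//.
by apply/seteqP; split => x /=; rewrite in_itv/= andbT subr_gt0.
Qed.

Definition shadow_pairs : set ((RR * RR) * (RR * RR)) :=
  [set P | sublevel q t P.1 /\ shadow P.1 P.2].

Let measurable_d1 : measurable_fun setT (fun P : (RR * RR) * (RR * RR) => d P.1).
Proof.
apply: measurable_funB => //; exact: measurableT_comp (@measurable_normc_cplx R) measurable_fst.
Qed.

Let measurable_d2 : measurable_fun setT (fun P : (RR * RR) * (RR * RR) => d P.2).
Proof.
apply: measurable_funB => //; exact: measurableT_comp (@measurable_normc_cplx R) measurable_snd.
Qed.

Lemma measurable_shadow_pairs : measurable shadow_pairs.
Proof.
have mE : measurable (sublevel q t).
  by apply: measurable_sublevel => z z1; apply: cdiff_ccont; exact: dq.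
have md : measurable_fun setT (fun P : (RR * RR) * (RR * RR) => nc (cplx P.1 - cplx P.2)).
  have m1 : measurable_fun setT (fun P : (RR * RR) * (RR * RR) =>
      ((P.1.1 - P.2.1, P.1.2 - P.2.2) : RR * RR)).
    apply: measurable_fun_pair; apply: measurable_funB.
    - exact: measurableT_comp measurable_fst measurable_fst.
    - exact: measurableT_comp measurable_fst measurable_snd.
    - exact: measurableT_comp measurable_snd measurable_fst.
    - exact: measurableT_comp measurable_snd measurable_snd.
  exact: measurableT_comp (@measurable_normc_cplx R) m1.
rewrite (_ : shadow_pairs = (fst @^-1` sublevel q t) `&`
  ([set P | 0 < d P.2] `&` ([set P | N * d P.1 <= d P.2] `&`
   ([set P | d P.2 < 2 * N * d P.1] `&` [set P | nc (cplx P.1 - cplx P.2) <= 2 * d P.2])))).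
  apply: measurableI; first by rewrite -[X in measurable X]setTI; exact: measurable_fst.
  apply: measurableI; first exact: measurable_lt_set.
  apply: measurableI; first by apply: measurable_le_set => //; exact: measurable_funM.
  apply: measurableI; first by apply: measurable_lt_set => //; exact: measurable_funM.
  by apply: measurable_le_set => //; exact: measurable_funM.
apply/seteqP; split => P /=; rewrite /shadow_pairs /shadow /= /d subr_gt0.
  by move=> [? [? ? ? ?]].
by move=> [? [? [? [? ?]]]].
Qed.

Lemma measurable_circle_section (S : set (RR * RR)) p : measurable S ->
  measurable (circle_section S p).
Proof.
move=> mS; have mf : measurable_fun setT (fun y : RR => rotate (cos y) (sin y) p).
  have mp : measurable_fun setT (fun y : RR => (y, p) : RR * (RR * RR)).
    by apply: measurable_fun_pair.
  exact: measurableT_comp (@measurable_rotate_angle R) mp.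
rewrite (_ : circle_section S p = `[0, 2 * pi]%classic `&`
    (fun y : RR => rotate (cos y) (sin y) p) @^-1` S).
  apply: measurableI; first exact: measurable_itv.
  by rewrite -[X in measurable X]setTI; exact: mf.
by apply/seteqP; split => y /=; rewrite /circle_section /= in_itv.
Qed.

(** The points whose shadow contains [p'] lie in a thin annulus of area at most [4 * d p' / N]. On
    each of its circles they have kernel at least [1 / (16 * d p')] and bump at least 1/2, so
    Chebyshev's inequality bounds their angles by [32 * d p' * (2 * pi * u)]. Averaging over
    rotations combines the two, with 128 = 4 * 32. *)
Lemma shadow_section_le p' : nc (cplx p') < 1 ->
  (mu2 (ysection shadow_pairs p') <=
   (128 * d p' ^+ 2 / N * complex.Re (bump q t (cplx p')))%:E)%E.
Proof.
move=> p1; have d0 := d_gt0 p1; set S := ysection _ _.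
set u := complex.Re _.
have u0 : 0 <= u by exact: Re_bump_ge0.
have mS : measurable S by exact: measurable_ysection measurable_shadow_pairs.
have dN : d p' / N <= 1 / 2.
  have d1 : d p' <= 1 by rewrite /d lerBlDr lerDl normc_ge0.
  by rewrite ler_pdivrMr//; move: N_ge2; lra.
have dN0 : 0 < d p' / N by rewrite divr_gt0.
(* The radii translate the two depth conditions of [shadow]; the large-inequality and strict sides
   match those of the annulus. *)
pose r1 := 1 - d p' / N; pose r2 := 1 - d p' / N / 2.
have r10 : 0 < r1 by rewrite /r1; lra.
have r12 : r1 <= r2 by rewrite /r1 /r2; lra.
pose A : set (RR * RR) := [set p | r1 ^+ 2 <= p.1 ^+ 2 + p.2 ^+ 2 < r2 ^+ 2]%R.
have mA : measurable A.
  rewrite (_ : A = [set p | r1 ^+ 2 <= p.1 ^+ 2 + p.2 ^+ 2] `&`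
     [set p | p.1 ^+ 2 + p.2 ^+ 2 < r2 ^+ 2]).
    by apply: measurableI; [apply: measurable_le_set|apply: measurable_lt_set] => //;
      exact: measurable_sqr_norm.
  by apply/seteqP; split => p /=; rewrite /A/= => /andP.
have depth p : S p -> [/\ d p <= d p' / N, d p' / N / 2 < d p,
    nc (cplx p - cplx p') <= 2 * d p' & nc (cplx p) < 1 /\ nc (q (cplx p)) < t].
  move=> /ysectionP[[pp1 qp] [_ h1 h2 h3]]; split => //.
    by rewrite ler_pdivlMr// mulrC.
  by rewrite -mulrA -invfM ltr_pdivrMr ?mulr_gt0// mulrC [N * 2]mulrC.
have SA y p : S (rotate (cos y) (sin y) p) -> A p.
  move=> /depth[h1 h2 _ _]; rewrite /A/= -!sqr_normc_cplx.
  have E : nc (cplx (rotate (cos y) (sin y) p)) = nc (cplx p).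
    by rewrite cplx_rotate normc_circle.
  have dE : d (rotate (cos y) (sin y) p) = 1 - nc (cplx p) by rewrite /d E.
  rewrite dE in h1 h2.
  have r20 : 0 < r2 by exact: lt_le_trans r12.
  rewrite ler_pXn2r ?nnegrE ?normc_ge0 ?(ltW r10)//.
  rewrite ltr_pXn2r ?nnegrE ?normc_ge0 ?(ltW r20)//.
  by rewrite /r1 /r2; apply/andP; split; lra.
have key p : A p -> (mu (circle_section S p) <= (32 * d p' * (2 * pi * u))%:E)%E.
  rewrite /A/= -!sqr_normc_cplx => /andP[a1 a2].
  have r20 : 0 < r2 by exact: lt_le_trans r12.
  rewrite ler_pXn2r ?nnegrE ?normc_ge0 ?(ltW r10)// in a1.
  rewrite ltr_pXn2r ?nnegrE ?normc_ge0 ?(ltW r20)// in a2.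
  apply: (@circle_measure_le R (bump q t) _ _ _ (cplx p)).
  - by move=> z z1; exact: cdiff_bump.
  - by move=> z z1; exact: Re_bump_ge0.
  - by rewrite mulr_ge0// ltW.
  - by apply: lt_trans a2 _; rewrite /r2; lra.
  - apply: lt_le_trans a1; rewrite /r1.
    have : nc (cplx p') = 1 - d p' by rewrite /d; ring.
    move=> ->; rewrite ltrD2l ltrN2 ltr_pdivrMr//.
    by rewrite ltr_pMr//; apply: lt_le_trans N_ge2; lra.
  - exact: measurable_circle_section.
  - by move=> y [].
  move=> y [_ Sy]; have [h1 h2 h3 [h4 h5]] := depth _ Sy.
  rewrite cplx_rotate in h3 h4 h5; have E := normc_circle (cplx p) y.
  have dE : d (rotate (cos y) (sin y) p) = 1 - nc (cplx p) by rewrite /d cplx_rotate E.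
  rewrite dE in h1 h2.
  have P1 : (16 * d p')^-1 <= poisson_kernel (nc (cplx p)) (cplx p') (cplx p * cexp 0 y).
    apply: poisson_kernel_lower => //.
      by rewrite subr_gt0; apply: lt_trans a2 _; rewrite /r2; lra.
    apply: le_trans h1 _; rewrite ler_pM2l// lef_pV2 ?posrE//.
  have u2 : 1 / 2 <= complex.Re (bump q t (cplx p * cexp 0 y)).
    exact: Re_bump_ge_half.
  have i0 : 0 <= (16 * d p')^-1 by rewrite invr_ge0 mulr_ge0// ltW.
  have h0' : 0 <= 1 / 2 :> R by rewrite divr_ge0.
  have K0 : 0 <= 32 * d p' by rewrite mulr_ge0// ltW.
  have := ler_wpM2l K0 (ler_pM i0 h0' P1 u2); apply: le_trans.
  by rewrite le_eqVlt; apply/orP; left; apply/eqP; field; rewrite gt_eqF.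
have K0 : 0 <= 32 * d p' * (2 * pi * u).
  by rewrite !mulr_ge0// ?pi_ge0// ltW.
have H := rotation_average K0 mS mA SA key.
have pi2 : 0 < 2 * pi :> R by rewrite mulr_gt0 ?pi_gt0.
have H2 : (mu2 A <= (4 * (d p' / N))%:E)%E.
  apply: le_trans (plane_measure_annulus_le r10 r12) _; rewrite lee_fin ler_pM2l//.
  rewrite (_ : r2 ^+ 2 - r1 ^+ 2 = (d p' / N / 2) * (r1 + r2)); last first.
    by rewrite /r1 /r2; field; rewrite gt_eqF.
  have : r1 + r2 <= 2 by rewrite /r1 /r2; lra.
  by move=> /(ler_wpM2l (ltW (divr_gt0 dN0 (ltr0n R 2)))); lra.
have : ((2 * pi)%:E * mu2 S <= (2 * pi)%:E * (128 * d p' ^+ 2 / N * u)%:E)%E.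
  apply: le_trans H _; apply: le_trans (lee_wpmul2l _ H2) _; first by rewrite lee_fin.
  rewrite -!EFinM lee_fin le_eqVlt; apply/orP; left; apply/eqP; field.
  by rewrite gt_eqF.
by rewrite lee_pmul2l// lte_fin.
Qed.

(* Equal to [d p ^- 2] on the disc, and measurable on the whole plane. *)
Let weight p := expR (- (ln (d p) *+ 2)).

Let weightE p : nc (cplx p) < 1 -> weight p = (d p ^+ 2)^-1.
Proof.
by move=> p1; rewrite /weight expRN -mulr_natl expRM_natl lnK// posrE d_gt0.
Qed.

Let weight_ge0 p : 0 <= weight p. Proof. exact: expR_ge0. Qed.

Let measurable_weight : measurable_fun setT weight.
Proof.
have md : measurable_fun setT d.
  by apply: measurable_funB => //; exact: measurable_normc_cplx.
have ml : measurable_fun setT (fun p => - (ln (d p) *+ 2)).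
  apply: measurable_funN; rewrite (_ : (fun p => _) = fun p => ln (d p) + ln (d p)).
    have m1 := measurableT_comp (@measurable_ln R) md.
    exact: measurable_funD.
  by apply/funext => p; rewrite mulr2n.
exact: measurableT_comp (@measurable_expR R) ml.
Qed.

(** The inverse square of the depth of [p'] offsets the area of a shadow, which is of order
    [(N * d p) ^+ 2], and on the other side cancels the [d p' ^+ 2] of [shadow_section_le]. *)
Let f (P : (RR * RR) * (RR * RR)) : \bar R := (weight P.2 * \1_shadow_pairs P)%:E.

Let f_ge0 P : (0 <= f P)%E.
Proof. by rewrite lee_fin mulr_ge0. Qed.

Let measurable_f : measurable_fun setT f.
Proof.
apply/measurable_EFinP; apply: measurable_funM.
  exact: measurableT_comp measurable_weight measurable_snd.
exact: measurable_indic measurable_shadow_pairs.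
Qed.

(** With s = N d(p), the square inside the shadow has area s^2/16, and the weight there is at least
    (2s)^-2 since the depth is below 2s. *)
Let integral_f_lower p : sublevel q t p -> ((64^-1)%:E <= \int[mu2]_p' f (p, p'))%E.
Proof.
move=> Ep; have [S [mS Ssub] mS2] := shadow_large Ep.
have [p1 _] := Ep; have d0 := d_gt0 p1.
set s := N * d p in mS2; have s0 : 0 < s by exact: mulr_gt0.
have c0 : 0 <= (4 * s ^+ 2)^-1 by rewrite invr_ge0 mulr_ge0// sqr_ge0.
rewrite (_ : 64^-1 = (4 * s ^+ 2)^-1 * (s ^+ 2 / 16)); last by field; rewrite gt_eqF.
rewrite EFinM -mS2 -(setTI S) setIC -integral_indic//.
rewrite -ge0_integralZl//; last first.
  by apply/measurable_EFinP; exact: measurable_indic.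
apply: ge0_le_integral => //.
- by move=> p' _; rewrite -EFinM lee_fin mulr_ge0.
- by apply/measurable_EFinP; apply: measurable_funM => //; exact: measurable_indic.
- exact: (@measurable_fun_pair2 _ _ _ _ _ _ f p measurable_f).
move=> p' _; rewrite -EFinM lee_fin; rewrite [\1_S p']indicE.
case: (boolP (p' \in S)) => [|_]; last by rewrite mulr0 mulr_ge0.
rewrite inE => /Ssub sh; have [p'1 h1 h2 _] := sh.
have d'0 := d_gt0 p'1.
rewrite indicE mem_set//= !mulr1 weightE//.
have s2 : 0 < 4 * s ^+ 2 by rewrite mulr_gt0// exprn_gt0.
have d2 : 0 < d p' ^+ 2 by rewrite exprn_gt0.
rewrite lef_pV2 ?posrE//.
rewrite (_ : 4 * s ^+ 2 = (2 * s) ^+ 2); last by ring.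
have ds : d p' <= 2 * s by rewrite /s mulrA ltW.
by rewrite ler_pXn2r ?nnegrE ?(ltW d'0)// mulr_ge0// ltW.
Qed.

(** A majorant of the bump on the larger sublevel set. It is instantiated by a combination of
    indicators of dyadic sublevel sets, whose integral is bounded by the corresponding combination
    of areas. *)
Variable b : RR * RR -> R.
Hypothesis b_ge0 : forall p, 0 <= b p.
Hypothesis mb : measurable_fun setT b.
Hypothesis ub : forall p, sublevel q h p -> complex.Re (bump q t (cplx p)) <= b p.

Let integral_f_upper p' :
  (\int[mu2]_p f (p, p') <= (128 / N * (b p' * \1_(sublevel q h) p'))%:E)%E.
Proof.
have E : (\int[mu2]_p f (p, p') = (weight p')%:E * mu2 (ysection shadow_pairs p'))%E.
  have mS : measurable (ysection shadow_pairs p').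
    exact: measurable_ysection measurable_shadow_pairs.
  rewrite -(setTI (ysection _ _)) setIC -integral_indic// -ge0_integralZl//; last 2 first.
  - by apply/measurable_EFinP; exact: measurable_indic.
  - by rewrite lee_fin.
  apply: eq_integral => p _; rewrite /f /= -EFinM; congr (_ * _)%:E.
  by rewrite !indicE mem_ysection.
rewrite E; have N1 : 0 <= 128 / N by rewrite divr_ge0// ltW.
have [Ep'|nEp'] := pselect (sublevel q h p'); last first.
  rewrite (_ : ysection _ _ = set0).
    by rewrite measure0 mule0 lee_fin; apply: mulr_ge0 N1 _; exact: mulr_ge0.
  by apply/seteqP; split => // p /ysectionP[Ep sh]; case: nEp'; exact: shadow_sublevel sh.
have [p'1 _] := Ep'; have d'0 := d_gt0 p'1.
apply: (@le_trans _ _ ((weight p')%:E *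
    (128 * d p' ^+ 2 / N * complex.Re (bump q t (cplx p')))%:E)%E).
  by rewrite lee_wpmul2l ?lee_fin//; exact: shadow_section_le.
rewrite -EFinM lee_fin indicE mem_set//= mulr1 weightE//.
rewrite [leLHS](_ : _ = 128 / N * complex.Re (bump q t (cplx p'))); last first.
  by field; rewrite !gt_eqF.
by rewrite ler_wpM2l// ub.
Qed.

Let measurable_sublevel_q r : measurable (sublevel q r).
Proof. by apply: measurable_sublevel => z z1; apply: cdiff_ccont; exact: dq. Qed.

Let double_integral_lower :
  ((64^-1)%:E * mu2 (sublevel q t) <= \int[mu2]_p \int[mu2]_p' f (p, p'))%E.
Proof.
have mt := measurable_sublevel_q t.
have -> : mu2 (sublevel q t) = (\int[mu2]_p (\1_(sublevel q t) p)%:E)%E.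
  by rewrite (integral_indic _ measurableT mt) setIT.
rewrite -ge0_integralZl//; last first.
  by apply/measurable_EFinP; exact: measurable_indic.
apply: ge0_le_integral => //.
- by apply/measurable_EFinP; apply: measurable_funM => //; exact: measurable_indic.
- exact: measurable_fun_fubini_tonelli_F.
move=> p _; rewrite -EFinM indicE; case: (boolP (p \in _)) => [|_].
  by rewrite inE mulr1 => /integral_f_lower.
by rewrite mulr0 integral_ge0.
Qed.

Let double_integral_upper : (\int[mu2]_p' \int[mu2]_p f (p, p') <=
  (128 / N)%:E * \int[mu2]_(p in sublevel q h) (b p)%:E)%E.
Proof.
have N1 : 0 <= 128 / N by rewrite divr_ge0// ltW.
have -> : (\int[mu2]_(p in sublevel q h) (b p)%:E =
    \int[mu2]_p (b p * \1_(sublevel q h) p)%:E)%E.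
  rewrite integral_mkcond; apply: eq_integral => p _.
  by rewrite patchE indicE; case: ifP => _; rewrite ?mulr1// mulr0.
have mB : measurable_fun setT (fun p => b p * \1_(sublevel q h) p).
  by apply: measurable_funM mb _; apply: measurable_indic; exact: measurable_sublevel_q.
rewrite -ge0_integralZl//; last 2 first.
- exact/measurable_EFinP.
- by move=> p _; rewrite lee_fin mulr_ge0.
apply: ge0_le_integral => //.
- by move=> p _; apply: integral_ge0.
- exact: measurable_fun_fubini_tonelli_G.
- by apply/measurable_EFinP; exact: measurable_funM.
Qed.

Lemma sublevel_measure_le :
  (mu2 (sublevel q t) <= (64 * 128 / N)%:E * \int[mu2]_(p in sublevel q h) (b p)%:E)%E.
Proof.
have Fub : (\int[mu2]_p \int[mu2]_p' f (p, p') = \int[mu2]_p' \int[mu2]_p f (p, p'))%E.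
  exact: fubini_tonelli.
have := double_integral_upper; rewrite -Fub => U.
have H := le_trans double_integral_lower U.
have h64 : 0 < 64 :> R by [].
rewrite (lee_pdivrMl _ _ h64) muleA -EFinM mulrA in H.
exact: H.
Qed.

End MainEstimate.

(** * Quadratic decay *)

Section Dyadic.
Variable R : realType.

(* With J_n the right-hand sum, J_n <= (1 + O(2^-n)) J_(n-1), so J is bounded. *)
Lemma dyadic_bootstrap (C1 : R) (n0 : nat) : 0 <= C1 -> exists2 K : R, 0 < K &
  forall a : nat -> R, (forall n, 0 <= a n) -> (forall n, a n <= a 0%N) ->
  (forall n, (n0 <= n)%N ->
     a n <= C1 / 4 ^+ n * \sum_(k < n.+1) 2 ^+ k.+1 * a k) ->
  forall n, a n <= K / 4 ^+ n * a 0%N.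
Proof.
move=> C10.
have [n1 n01 Cn1] : exists2 n1, (n0 <= n1)%N & 4 * C1 <= 2 ^+ n1.
  exists (n0 + Num.truncn (4 * C1)).+1; first by rewrite ltnW// ltnS leq_addr.
  apply: ltW; apply: lt_le_trans (Num.Theory.truncnS_gt _) _.
  rewrite -natrX ler_nat; apply: leq_trans (ltn_expl _ (ltnSn 1)).
  by rewrite ltnS ltnW// ltnS leq_addl.
(* The first summand serves the indices from [n1] on, where the recursion contracts; the second
   makes the claim follow from [a n <= a 0] below [n1]. *)
pose K := C1 * expR 1 * 2 ^+ n1.+2 + 4 ^+ n1.
have K1 : 0 <= C1 * expR 1 * 2 ^+ n1.+2
  by exact: mulr_ge0 (mulr_ge0 C10 (expR_ge0 _)) (exprn_ge0 _ _).
exists K; first by apply: ltr_wpDl K1 _; rewrite exprn_gt0.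
move=> a a0 am aC.
pose J n := \sum_(k < n.+1) 2 ^+ k.+1 * a k.
have JS n : J n.+1 = J n + 2 ^+ n.+2 * a n.+1 by rewrite /J big_ord_recr.
have J0 n : 0 <= J n by apply: sumr_ge0 => k _; rewrite mulr_ge0 ?exprn_ge0.
have Jle n : J n <= 2 ^+ n.+2 * a 0%N.
  elim: n => [|n IH].
    by rewrite /J big_ord_recl big_ord0 addr0 /= ler_wpM2r// ler_eXn2l// ltr1n.
  rewrite JS; apply: le_trans (lerD IH (ler_wpM2l _ (am _))) _; first by rewrite exprn_ge0.
  by rewrite -mulrDl ler_wpM2r// [leRHS]exprS mulr_natl mulr2n.
have p2 n : 0 < 2 ^+ n :> R by rewrite exprn_gt0.
have step n : (n1 <= n)%N -> J n.+1 <= expR (4 * C1 / 2 ^+ n.+1) * J n.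
  move=> nn; set x := 2 * C1 / 2 ^+ n.+1.
  have x0 : 0 <= x by rewrite divr_ge0 ?mulr_ge0// ltW.
  have x2 : x <= 1 / 2.
    rewrite ler_pdivrMr// exprS.
    have : 2 ^+ n1 <= 2 ^+ n :> R by rewrite ler_eXn2l// ltr1n.
    by move: Cn1; lra.
  (* The recursion bounds the last term of [J n.+1] by [x] times [J n.+1] itself. As [x <= 1 / 2],
     this is absorbed at the price of a factor [1 + 2 * x]. *)
  have H : J n.+1 <= J n + x * J n.+1.
    rewrite {1}JS lerD2l.
    have := aC n.+1 (leq_trans n01 (leqW nn)); rewrite -/(J n.+1).
    move=> /(ler_wpM2l (ltW (p2 n.+2))); move/le_trans; apply.
    rewrite le_eqVlt; apply/orP; left; apply/eqP.
    have -> : 4 ^+ n.+1 = 2 ^+ n.+1 * 2 ^+ n.+1 :> R by rewrite -exprMn; congr (_ ^+ _); ring.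
    by rewrite /x exprS; field; rewrite gt_eqF.
  apply: (@le_trans _ _ ((1 + 2 * x) * J n)).
    have : x * (x * J n.+1) <= 1 / 2 * (x * J n.+1) by rewrite ler_wpM2r// mulr_ge0.
    have := ler_wpM2l x0 H; set xj := x * J n.+1 in H *; set xx := x * xj.
    by rewrite mulrDr -/xx mulrDl mul1r -mulrA; lra.
  rewrite ler_wpM2r// (_ : 4 * C1 / 2 ^+ n.+1 = 2 * x); last by rewrite /x; ring.
  exact: expR_ge1Dx.
(* The exponents from [step] form a geometric series, here in closed form. Its total is at most
   [4 * C1 / 2 ^+ n1 <= 1], whence the [expR 1] in [K]. *)
have Jn n : J (n1 + n)%N <= expR (4 * C1 * (1 / 2 ^+ n1 - 1 / 2 ^+ (n1 + n))) * J n1.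
  elim: n => [|n IH]; first by rewrite addn0 subrr mulr0 expR0 mul1r.
  rewrite addnS; apply: le_trans (step _ (leq_addr _ _)) _.
  apply: le_trans (ler_wpM2l (expR_ge0 _) IH) _.
  rewrite mulrA -expRD le_eqVlt; apply/orP; left; apply/eqP; congr (expR _ * _).
  by rewrite exprS; field; rewrite !gt_eqF.
have Jb n : (n1 <= n)%N -> J n <= expR 1 * 2 ^+ n1.+2 * a 0%N.
  move=> /subnKC <-; apply: le_trans (Jn _) _; rewrite -[leRHS]mulrA.
  apply: ler_pM (expR_ge0 _) (J0 _) _ (Jle _).
  rewrite ler_expR; have : 4 * C1 * (1 / 2 ^+ n1) <= 1.
    by rewrite mul1r ler_pdivrMr// mul1r.
  rewrite mulrBr; have : 0 <= 4 * C1 * (1 / 2 ^+ (n1 + (n - n1))).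
    by rewrite !mulr_ge0// invr_ge0 ltW.
  by lra.
move=> n; have p4 : 0 < 4 ^+ n :> R by rewrite exprn_gt0.
have [nn|nn] := leqP n1 n.
  apply: le_trans (aC _ (leq_trans n01 nn)) _.
  have c0 : 0 <= C1 / 4 ^+ n by rewrite divr_ge0// ltW.
  apply: le_trans (ler_wpM2l c0 (Jb _ nn)) _.
  rewrite [leLHS](_ : _ = C1 * expR 1 * 2 ^+ n1.+2 / 4 ^+ n * a 0%N); last by ring.
  by rewrite ler_wpM2r// ler_wpM2r ?invr_ge0 ?(ltW p4)// lerDl exprn_ge0.
apply: le_trans (am n) _; rewrite ler_peMl// ler_pdivlMr// mul1r.
apply: (@le_trans _ _ (4 ^+ n1)); last by rewrite lerDr.
by rewrite ler_eXn2l ?ltr1n// ltnW.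
Qed.

(** One term suffices: let k be the last index up to n with x < 2^-k h, which exists since x < h. If
    k = n its weight is 2; if k < n, then x >= 2^-(k+1) h, so 2^-n h / x is at most the weight
    2^(k+1) / 2^n. *)
Lemma dyadic_majorant (x h : R) n : 0 < x -> 0 < h -> x < h ->
  Num.min 1 ((2 ^+ n)^-1 * h / x) <=
  \sum_(k < n.+1) 2 ^+ k.+1 / 2 ^+ n * (x < (2 ^+ k)^-1 * h)%R%:R.
Proof.
move=> x0 h0 xh; have p2 m : 0 < 2 ^+ m :> R by rewrite exprn_gt0.
pose B m : R := \sum_(k < m.+1) 2 ^+ k.+1 / 2 ^+ m * (x < (2 ^+ k)^-1 * h)%R%:R.
have BS m : B m.+1 = B m / 2 + 2 * (x < (2 ^+ m.+1)^-1 * h)%R%:R.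
  rewrite /B big_ord_recr /=; congr (_ + _ * _).
    rewrite mulr_suml; apply: eq_bigr => k _; rewrite [2 ^+ m.+1]exprS; field.
    by rewrite gt_eqF.
  by rewrite [2 ^+ m.+2]exprS mulfK// gt_eqF.
have B0 m : 0 <= B m.
  by apply: sumr_ge0 => k _; rewrite mulr_ge0// divr_ge0// ltW.
have B2 m : x < (2 ^+ m)^-1 * h -> 2 <= B m.
  case: m => [|m] xm; last by rewrite BS xm mulr1 lerDr divr_ge0.
  by rewrite /B big_ord_recl big_ord0 addr0 /= xm mulr1 divr1 expr1.
rewrite -/(B n).
have [xn|nx] := ltP x ((2 ^+ n)^-1 * h).
  by rewrite ge_min; apply/orP; left; apply: le_trans (B2 _ xn); lra.
rewrite ge_min; apply/orP; right; elim: n nx => [|n IH] nx.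
  by move: nx xh; rewrite expr0 invr1 mul1r => /le_lt_trans H /H; rewrite ltxx.
have E : (2 ^+ n.+1)^-1 * h / x = (2 ^+ n)^-1 * h / x / 2.
  by rewrite exprS; field; rewrite !gt_eqF.
rewrite E BS; have [xn|nx'] := ltP x ((2 ^+ n)^-1 * h).
  rewrite -E; apply: (@le_trans _ _ 1); first by rewrite ler_pdivrMr// mul1r.
  have := B2 _ xn; have : 0 <= (x < (2 ^+ n.+1)^-1 * h)%R%:R :> R by []; lra.
have : 0 <= (x < (2 ^+ n.+1)^-1 * h)%R%:R :> R by [].
by have := IH nx'; lra.
Qed.
End Dyadic.

(** * The recursion for the areas of dyadic sublevel sets *)

Section DyadicSublevels.
Variable R : realType.
Local Notation C := R[i].
Local Notation nc := (@normc R).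
Local Notation mu2 := (@plane_measure R).
Local Notation RR := (measurableTypeR R).
Variable q : C -> C.
Hypothesis dq : forall z, nc z < 1 -> cdiff q z.
Hypothesis q0 : forall z, nc z < 1 -> 0 < complex.Re (q z).
Variable h : R.
Hypotheses (h0 : 0 < h) (hq : h < nc (q 0)).

Lemma measurable_sublevel_cdiff t : measurable (sublevel q t).
Proof. by apply: measurable_sublevel => z z1; apply: cdiff_ccont; exact: dq. Qed.

Lemma plane_measure_sublevel_fin t : mu2 (sublevel q t) \is a fin_num.
Proof.
have H : (mu2 (sublevel q t) <= 4%:E)%E.
  apply: le_trans (@plane_measure_unit_disc_le R).
  apply: le_measure; rewrite ?inE; [exact: measurable_sublevel_cdiff|exact: measurable_disc|].
  move=> p [p1 _]; rewrite /disc/= expr1n -sqr_normc_cplx.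
  by rewrite expr_lt1// normc_ge0.
by rewrite ge0_fin_numE//; apply: le_lt_trans H _; rewrite ltry.
Qed.
Let mE := measurable_sublevel_cdiff.
Let fin_mu2 := plane_measure_sublevel_fin.

Let e n : R := (2 ^+ n)^-1.
Let e_gt0 n : 0 < e n. Proof. by rewrite invr_gt0 exprn_gt0. Qed.
Let a n : R := fine (mu2 (sublevel q (e n * h))).
Let aE n : mu2 (sublevel q (e n * h)) = (a n)%:E.
Proof. by rewrite /a fineK. Qed.

Let weight n k : R := 2 ^+ k.+1 / 2 ^+ n.
Let weight_ge0 n k : 0 <= weight n k.
Proof. by rewrite divr_ge0// exprn_ge0. Qed.
Let b n p : R := \sum_(k < n.+1) weight n k * \1_(sublevel q (e k * h)) p.

Let mb n : measurable_fun setT (b n).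
Proof.
apply: measurable_sum => k; apply: measurable_funM => //.
Qed.

Let b_ge0 n p : 0 <= b n p.
Proof. by apply: sumr_ge0 => k _; rewrite mulr_ge0. Qed.

Let bump_le_b n p : sublevel q h p -> complex.Re (bump q (e n * h) (cplx p)) <= b n p.
Proof.
move=> [p1 ph].
have t0 : 0 < e n * h by rewrite mulr_gt0.
have x0 : 0 < nc (q (cplx p)) by exact: normc_q_gt0 q0 _ p1.
apply: (@le_trans _ _ (Num.min 1 (e n * h / nc (q (cplx p))))).
  by rewrite le_min Re_bump_le1// Re_bump_le.
apply: le_trans (dyadic_majorant n x0 h0 ph) _.
apply: ler_sum => k _; rewrite ler_wpM2l// indicE.
by case: ltP => [H|_]; rewrite ?ler0n// mem_set.
Qed.

Let integral_b n : (\int[mu2]_(p in sublevel q h) (b n p)%:E <=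
  (\sum_(k < n.+1) weight n k * a k)%:E)%E.
Proof.
have mI k : measurable_fun setT (\1_(sublevel q (e k * h)) : RR * RR -> R).
  by apply: measurable_indic; exact: mE.
have mD := mE h.
have -> : (\int[mu2]_(p in sublevel q h) (b n p)%:E = \int[mu2]_(p in sublevel q h)
    (\sum_(k < n.+1) (weight n k * \1_(sublevel q (e k * h)) p)%:E))%E.
  by apply: eq_integral => p _; rewrite sumEFin.
rewrite ge0_integral_sum//; last 2 first.
- move=> k; apply: measurable_funTS; apply/measurable_EFinP.
  by apply: measurable_funM => //; exact: mI.
- by move=> k p _; rewrite lee_fin mulr_ge0.
rewrite -sumEFin; apply: lee_sum => k _.
have -> : (\int[mu2]_(p in sublevel q h) (weight n k * \1_(sublevel q (e k * h)) p)%:E =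
    \int[mu2]_(p in sublevel q h) ((weight n k)%:E * (\1_(sublevel q (e k * h)) p)%:E))%E.
  by apply: eq_integral => p _; rewrite EFinM.
rewrite ge0_integralZl//; last 2 first.
- by apply: measurable_funTS; apply/measurable_EFinP; exact: mI.
- by rewrite lee_fin.
rewrite (integral_indic _ mD (mE _)) [leRHS]EFinM -aE lee_wpmul2l ?lee_fin//.
by apply: le_measure; rewrite ?inE//; exact: measurableI.
Qed.

Lemma dyadic_sublevel_le n : (11 <= n)%N ->
  fine (mu2 (sublevel q ((2 ^+ n)^-1 * h))) <= 64 * 128 * (8 * 100) / 4 ^+ n *
  \sum_(k < n.+1) 2 ^+ k.+1 * fine (mu2 (sublevel q ((2 ^+ k)^-1 * h))).
Proof.
rewrite -/(e n) -/(a n).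
(* This [N] makes the constraint between [eps] and [N] an equality. The condition [2 <= N] asks for
   2^n >= 1600, whence the threshold 11. One factor [2 ^- n] comes from [1 / N], the other from the
   weights. *)
move=> n11; pose N : R := 2 ^+ n / (8 * 100).
have N2 : 2 <= N.
  rewrite ler_pdivlMr//; apply: (@le_trans _ _ (2 ^+ 11)); last first.
    by rewrite ler_eXn2l// ltr1n.
  by rewrite !exprS expr0; lra.
have p2 : 0 < 2 ^+ n :> R by rewrite exprn_gt0.
have eN : 8 * (100 * (e n * N)) <= 1.
  by rewrite le_eqVlt /e /N; apply/orP; left; apply/eqP; field; rewrite gt_eqF.
have c0 : 0 <= 64 * 128 / N by rewrite divr_ge0// (le_trans _ N2).
have := @sublevel_measure_le R q dq q0 h (e n) N h0 hq (e_gt0 n) N2 eN (b n)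
  (@b_ge0 n) (@mb n) (@bump_le_b n).
rewrite aE => /le_trans /(_ (lee_wpmul2l _ (integral_b n))).
rewrite -EFinM !lee_fin => /(_ c0) /le_trans; apply.
rewrite !mulr_sumr; apply: ler_sum => k _.
have -> : 4 ^+ n = 2 ^+ n * 2 ^+ n :> R by rewrite -exprMn; congr (_ ^+ _); ring.
rewrite -/(e k) -/(a k) le_eqVlt /weight /N; apply/orP; left; apply/eqP; field.
by rewrite gt_eqF.
Qed.
End DyadicSublevels.

Lemma le_sublevel (R : realType) (q : R[i] -> R[i]) (s t : R) :
  s <= t -> sublevel q s `<=` sublevel q t.
Proof. by move=> st p [p1 qs]; split=> //; exact: lt_le_trans qs st. Qed.

Lemma dyadic_scale (R : realType) (x : R) : 0 < x -> x <= 1 ->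
  exists2 n, (2 ^+ n.+1)^-1 < x & x <= (2 ^+ n)^-1.
Proof.
move=> x0 x1.
have p2 n : 0 < 2 ^+ n :> R by rewrite exprn_gt0.
have H : exists n, (2 ^+ n.+1)^-1 < x.
  exists (Num.truncn x^-1); rewrite invf_plt ?posrE//.
  apply: lt_trans (Num.Theory.truncnS_gt _) _.
  by rewrite -natrX ltr_nat ltn_expl.
case: (ex_minnP H) => n xn min_n; exists n => //.
case: n xn min_n => [|n] xn min_n; first by rewrite expr0 invr1.
by rewrite leNgt; apply/negP => /min_n; rewrite ltnn.
Qed.

Lemma sublevel_decay (R : realType) : exists2 K : R, 0 < K &
  forall q : R[i] -> R[i], (forall z, normc z < 1 -> cdiff q z) ->
  (forall z, normc z < 1 -> 0 < complex.Re (q z)) ->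
  forall h eps : R, 0 < h -> h < normc (q 0) -> 0 < eps -> eps <= 1 ->
  (plane_measure (sublevel q (eps * h)) <=
     (K * eps ^+ 2)%:E * plane_measure (sublevel q h))%E.
Proof.
have C0 : 0 <= 64 * 128 * (8 * 100) :> R by rewrite !mulr_ge0.
have [K K0 HK] := dyadic_bootstrap 11 C0.
(* The 4 pays for rounding [eps] up to a power of 1/2, which less than doubles it. *)
exists (4 * K); first by rewrite mulr_gt0.
move=> q dq q0 h eps h0 hq e0 e1.
have mE t : measurable (sublevel q t) by exact: measurable_sublevel_cdiff.
have fin t : plane_measure (sublevel q t) \is a fin_num by exact: plane_measure_sublevel_fin.
pose a n := fine (plane_measure (sublevel q ((2 ^+ n)^-1 * h))).
have mono s t : s <= t ->
    (plane_measure (sublevel q s) <= plane_measure (sublevel q t))%E.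
  move=> st; apply: le_measure; rewrite ?inE; [exact: mE|exact: mE|].
  exact: le_sublevel.
have a_le n : a n <= a 0%N.
  rewrite fine_le// mono// ler_wpM2r ?(ltW h0)// expr0 invr1.
  by rewrite invf_le1 ?exprn_gt0// exprn_ege1// ler1n.
have := HK a (fun n => fine_ge0 (measure_ge0 _ _)) a_le
  (fun n => @dyadic_sublevel_le R q dq q0 h h0 hq n).
have [n en ne] := dyadic_scale e0 e1.
move=> /(_ n) an.
apply: (@le_trans _ _ (a n)%:E); first by rewrite fineK// mono// ler_wpM2r// ltW.
apply: (@le_trans _ _ (K / 4 ^+ n * a 0%N)%:E); first by rewrite lee_fin.
rewrite EFinM /a expr0 invr1 mul1r fineK// lee_wpmul2r// lee_fin.
rewrite ler_pdivrMr ?exprn_gt0//.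
have -> : 4 * K * eps ^+ 2 * 4 ^+ n = K * (eps * 2 ^+ n.+1) ^+ 2.
  have -> : 4 ^+ n = 2 ^+ n * 2 ^+ n :> R by rewrite -exprMn; congr (_ ^+ _); ring.
  by rewrite [2 ^+ n.+1]exprS; ring.
rewrite ler_peMr ?(ltW K0)// exprn_ege1//.
by move: en; rewrite invf_plt ?posrE ?exprn_gt0// => /ltW; rewrite -ler_pdivrMl// mulr1.
Qed.

(** * From Carleson boxes to sublevel sets in the half-plane *)

Section Translation.
Variable R : realType.
Local Notation C := R[i].
Local Notation nc := (@normc R).
Variables (phi : C -> C) (xi : C).
Hypotheses (phi_analytic : analytic_on_disk phi)
  (phi_disk : forall z, unit_disk z -> unit_disk (phi z)) (xi1 : nc xi = 1).

Let q (z : C) : C := 1 - (xi^*)%C * phi z.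

Lemma normc_one_sub_conj_mul z : nc (q z) = nc (phi z - xi).
Proof.
have -> : q z = - (xi^*)%C * (phi z - xi).
  have E : xi * (xi^*)%C = 1 by rewrite mulcJ_normc xi1 expr1n.
  by rewrite /q -E; ring.
by rewrite normcM normcN normcJ xi1 mul1r.
Qed.

Lemma Re_one_sub_conj_mul_gt0 z : nc z < 1 -> 0 < complex.Re (q z).
Proof.
move=> /phi_disk phi1.
have H : complex.Re ((xi^*)%C * phi z) < 1.
  apply: le_lt_trans (ler_norm _) _; apply: le_lt_trans (Re_le_normc _) _.
  by rewrite normcM normcJ xi1 mul1r.
rewrite /q; move: H; case: (_ * _) => a b /=; lra.
Qed.

Lemma cdiff_one_sub_conj_mul z : nc z < 1 -> cdiff q z.
Proof.
move=> z1; apply: (@cdiffB _ (fun=> 1) (fun z => (xi^*)%C * phi z)).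
  exact: cdiff_cst.
apply: (@cdiffM _ (fun=> (xi^*)%C) phi); first exact: cdiff_cst.
by apply: complex_differentiable_cdiff; exact: phi_analytic.
Qed.

Lemma area_carleson_preimageE t :
  area [set z | unit_disk z /\ carleson_box xi t (phi z)] =
  ((pi^-1)%:E * plane_measure (sublevel q t))%E.
Proof.
suff -> : sublevel q t = [set p | unit_disk (Complex p.1 p.2) /\
    carleson_box xi t (phi (Complex p.1 p.2))] by [].
apply/seteqP; split => p /=; last first.
  by move=> [p1 [_ H]]; split => //; rewrite normc_one_sub_conj_mul.
move=> [p1]; rewrite normc_one_sub_conj_mul => H.
by split=> //; split=> //; exact: phi_disk.
Qed.
End Translation.

Theorem theorem3p1 (R : realType) :
  exists C0 : R, 0 < C0 /\
  forall phi : R[i] -> R[i],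
    analytic_on_disk phi ->
    (forall z, unit_disk z -> unit_disk (phi z)) ->
    forall (xi : R[i]) (h eps : R),
      ComplexField.Normc.normc xi = 1 ->
      0 < h -> h < 1 - ComplexField.Normc.normc (phi 0) ->
      0 < eps -> eps <= 1 ->
      (area [set z | unit_disk z /\ carleson_box xi (eps * h) (phi z)]
       <= (C0 * eps ^+ 2)%:E *
          area [set z | unit_disk z /\ carleson_box xi h (phi z)])%E.
Proof.
have [K K0 HK] := sublevel_decay R; exists K; split=> //.
move=> phi phi_an phi_disk xi h eps xi1 h0 hphi e0 e1.
rewrite !area_carleson_preimageE// muleCA lee_wpmul2l//.
  by rewrite lee_fin invr_ge0 pi_ge0.
apply: HK => //.
- by move=> z; exact: cdiff_one_sub_conj_mul.
- by move=> z; exact: Re_one_sub_conj_mul_gt0.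
(* Since [|xi| = 1], the distance [|q 0|] from [phi 0] to [xi] is at least [1 - |phi 0|], hence
   exceeds [h]. *)
rewrite normc_one_sub_conj_mul// normc_distC; apply: lt_le_trans hphi _.
by rewrite -xi1 normc_dist_ge.
Qed.
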